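(* Let $n$ be a positive integer. For every $R>0$ there is a constant $C'(R)$, depending only on $R$ and the dimension $n$, such that the following holds. Let $K,L\subset\mathbb{R}^n$ be convex bodies such that $K_2=K+2B^n$ and $L_2=L+2B^n$ are both contained in some ball of radius $R$. Then $$ d_{bL}(S_{n-1}(K,\cdot),S_{n-1}(L,\cdot))\le C'(R)\,d_H(K,L)^{1/2}, $$ where $S_{n-1}(K,\cdot)$ denotes the area measure of $K$ on the unit sphere $\mathbb{S}^{n-1}$, $d_{bL}$ the bounded Lipschitz metric for finite Borel measures on $\mathbb{S}^{n-1}$, and $d_H$ the Hausdorff metric.
   Context: A convex body in $\mathbb{R}^n$ is a nonempty compact convex subset; $B^n$ is the closed unit ball and $|\cdot|$ the Euclidean norm. For $\rho\ge 0$, $K_\rho:=K+\rho B^n$ is the parallel body of $K$. The Hausdorff distance is $d_H(K,L)=\min\{\rho\ge0: K\subset L_\rho,\ L\subset K_\rho\}$. For a convex body $K$ and $x\in\mathbb{R}^n$, $p_K(x)$ is the unique point of $K$ nearest to $x$, $d_K(x)=|x-p_K(x)|$, and for $x\notin K$, $u_K(x)=(x-p_K(x))/d_K(x)\in\mathbb{S}^{n-1}$. For $\rho>0$, $K^\rho:=K_\rho\setminus K$. Let $\Sigma^n:=\mathbb{R}^n\times\mathbb{S}^{n-1}$. For Borel $\eta\subset\Sigma^n$ put $$\mu_{K,\rho}(\eta):=\mathcal{H}^n(\{x\in K^\rho:(p_K(x),u_K(x))\in\eta\}),$$ where $\mathcal{H}^n$ is $n$-dimensional Hausdorff measure. The support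 measures $\Lambda_0(K,\cdot),\dots,\Lambda_{n-1}(K,\cdot)$ are the finite Borel measures on $\Sigma^n$ uniquely determined by $$\mu_{K,\rho}(\eta)=\sum_{i=0}^{n-1}\rho^{n-i}\kappa_{n-i}\Lambda_i(K,\eta)\quad\text{for all }\rho>0\text{ and all Borel }\eta\subset\Sigma^n,$$ where $\kappa_j$ is the $j$-dimensional volume of $B^j$ (the existence of this expansion, the local Steiner formula, is a known fact). The area measure is $S_{n-1}(K,\omega)=2\Lambda_{n-1}(K,\mathbb{R}^n\times\omega)$ for Borel sets $\omega\subset\mathbb{S}^{n-1}$. For finite Borel measures $\mu,\nu$ on $\mathbb{S}^{n-1}$, $$d_{bL}(\mu,\nu):=\sup\left\{\left|\int f\,d\mu-\int f\,d\nu\right|: f:\mathbb{S}^{n-1}\to\mathbb{R},\ \|f\|_L\le1,\ \|f\|_\infty\le1\right\},$$ where $\|f\|_L=\sup_{a\ne b}|f(a)-f(b)|/|a-b|$ (Euclidean distance) and $\|f\|_\infty=\sup_a|f(a)|$. *)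

(* Defs.v *)
From HB Require Import structures.
From mathcomp Require Import all_boot all_order all_algebra.
From mathcomp Require Import all_classical all_reals all_analysis.

Set Implicit Arguments.
Unset Strict Implicit.
Unset Printing Implicit Defensive.

Import Order.TTheory GRing.Theory Num.Theory.
Import numFieldNormedType.Exports.

Local Open Scope classical_set_scope.
Local Open Scope ring_scope.

(* The library norm `|x| on 'rV[R]_n is the max norm, hence this definition;
   the topologies (and so the Borel sets and the compact sets) agree. *)
Definition enorm (R : realType) (n : nat) (x : 'rV[R]_n) : R :=
  Num.sqrt (\sum_(i < n) x ord0 i ^+ 2).

Definition cball (R : realType) (n : nat) (z : 'rV[R]_n) (r : R) :
    set 'rV[R]_n :=
  [set x | enorm (x - z) <= r].

Definition unit_ball (R : realType) (n : nat) : set 'rV[R]_n := cball 0 1.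

Definition usphere (R : realType) (n : nat) : set 'rV[R]_n :=
  [set x | enorm x = 1].

Definition convex_body (R : realType) (n : nat) (K : set 'rV[R]_n) : Prop :=
  [/\ K !=set0, compact K & convex_set (K : set (convex_lmodType 'rV[R]_n))].

Definition parallel (R : realType) (n : nat) (K : set 'rV[R]_n) (rho : R) :
    set 'rV[R]_n :=
  [set a + rho *: b | a in K & b in @unit_ball R n].

Definition hausdorff_dist (R : realType) (n : nat) (K L : set 'rV[R]_n) : R :=
  inf [set rho | [/\ 0 <= rho, K `<=` parallel L rho & L `<=` parallel K rho]].

(* Lebesgue outer measure on R^n, by countable covers with closed boxes. *)
Definition box (R : realType) (n : nat) (a b : 'rV[R]_n) : set 'rV[R]_n :=
  [set x | forall i, a ord0 i <= x ord0 i <= b ord0 i].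

Definition lebesgue_outer (R : realType) (n : nat) (A : set 'rV[R]_n) : \bar R :=
  ereal_inf [set s | exists a b : nat -> 'rV[R]_n,
    [/\ forall k i, a k ord0 i <= b k ord0 i,
        A `<=` \bigcup_k box (a k) (b k) &
        s = (\sum_(0 <= k <oo)
              (\prod_(i < n) (b k ord0 i - a k ord0 i))%:E)%E]].

Definition kappa (R : realType) (n : nat) : R :=
  fine (lebesgue_outer (@unit_ball R n)).

(* ediam set0 = -oo, and fine (-oo) = 0: for n > 0 empty pieces contribute 0
   to the sums in hausdorff_pre. *)
Definition ediam (R : realType) (n : nat) (A : set 'rV[R]_n) : \bar R :=
  ereal_sup [set (enorm (x - y))%:E | x in A & y in A].

(* n-dimensional Hausdorff measure on R^n, n > 0, with the factor
   kappa_n / 2^n that makes it agree with Lebesgue measure. *)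
Definition hausdorff_pre (R : realType) (n : nat) (delta : R)
    (A : set 'rV[R]_n) : \bar R :=
  ereal_inf [set (\sum_(0 <= k <oo)
                   (kappa R n * (fine (ediam (F k)) / 2) ^+ n)%:E)%E
            | F in [set F : nat -> set 'rV[R]_n |
                (forall k, (ediam (F k) <= delta%:E)%E) /\
                A `<=` \bigcup_k F k]].

Definition hausdorff_measure (R : realType) (n : nat) (A : set 'rV[R]_n) :
    \bar R :=
  ereal_sup [set hausdorff_pre delta A | delta in [set delta : R | 0 < delta]].

(* The nearest point of K; xget picks the unique element (0 if K has none). *)
Definition nearest_pt (R : realType) (n : nat) (K : set 'rV[R]_n)
    (x : 'rV[R]_n) : 'rV[R]_n :=
  xget 0 [set y | K y /\ forall z, K z -> enorm (x - y) <= enorm (x - z)].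

Definition dist_to (R : realType) (n : nat) (K : set 'rV[R]_n)
    (x : 'rV[R]_n) : R :=
  enorm (x - nearest_pt K x).

Definition outer_dir (R : realType) (n : nat) (K : set 'rV[R]_n)
    (x : 'rV[R]_n) : 'rV[R]_n :=
  (dist_to K x)^-1 *: (x - nearest_pt K x).

(* Borel measures on R^n x S^(n-1) and on S^(n-1) are encoded as Borel measures
   on the ambient spaces R^n x R^n and R^n that vanish off the subset: the Borel
   subsets of a closed subset are the ambient Borel sets contained in it. *)
Notation vecB R n := (g_sigma_algebraType (@open 'rV[R]_n)).
Notation pairB R n := (g_sigma_algebraType (@open ('rV[R]_n * 'rV[R]_n)%type)).

Definition Sigma (R : realType) (n : nat) : set ('rV[R]_n * 'rV[R]_n) :=
  [set: 'rV[R]_n] `*` @usphere R n.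

Definition local_parallel_measure (R : realType) (n : nat) (K : set 'rV[R]_n)
    (rho : R) (eta : set ('rV[R]_n * 'rV[R]_n)) : \bar R :=
  hausdorff_measure
    [set x | (parallel K rho `\` K) x /\ eta (nearest_pt K x, outer_dir K x)].

(* Lam 0, ..., Lam (n-1) are the support measures of K: the local Steiner
   formula determines them uniquely. *)
Definition support_measures (R : realType) (n : nat) (K : set 'rV[R]_n)
    (Lam : nat -> {finite_measure set (pairB R n) -> \bar R}) : Prop :=
  (forall i, (i < n)%N -> Lam i (~` @Sigma R n) = 0%E) /\
  (forall (rho : R) (eta : set (pairB R n)),
     0 < rho -> measurable eta -> eta `<=` @Sigma R n ->
     local_parallel_measure K rho eta =
     (\sum_(i < n) (rho ^+ (n - i) * kappa R (n - i))%:E * Lam i eta)%E).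

Section area_measure.
Variables (R : realType) (n : nat).
Variable Lam : nat -> {finite_measure set (pairB R n) -> \bar R}.
Local Open Scope ereal_scope.

Definition area_measure (omega : set (vecB R n)) : \bar R :=
  2%:E * Lam n.-1 ([set: 'rV[R]_n] `*` omega).

Let pre (omega : set (vecB R n)) : [set: 'rV[R]_n] `*` omega = snd @^-1` omega.
Proof. by apply/seteqP; split => [[x y] []|[x y]]. Qed.

Let measurable_snd : measurable_fun [set: pairB R n] (snd : _ -> vecB R n).
Proof.
apply: (@measurability _ _ (pairB R n) (vecB R n) _ _ (@open 'rV[R]_n)) => //.
move=> _ [B oB <-]; rewrite setTI; apply: sub_sigma_algebra.
by apply: open_comp oB => x _; exact: cvg_snd.
Qed.

Let mpre (omega : set (vecB R n)) : measurable omega ->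
  measurable ([set: 'rV[R]_n] `*` omega : set (pairB R n)).
Proof.
by move=> mo; rewrite pre -[X in measurable X]setTI; exact: measurable_snd.
Qed.

Let area_measure0 : area_measure set0 = 0.
Proof. by rewrite /area_measure setX0 measure0 mule0. Qed.

Let area_measure_ge0 omega : 0 <= area_measure omega.
Proof. by rewrite /area_measure mule_ge0. Qed.

Let area_measure_sigma_additive : semi_sigma_additive area_measure.
Proof.
move=> F mF tF mUF; rewrite /area_measure.
have -> : [set: 'rV[R]_n] `*` \bigcup_k F k = \bigcup_k ([set: 'rV[R]_n] `*` F k : set (pairB R n)).
  by rewrite pre preimage_bigcup; apply: eq_bigcupr => k _; rewrite pre.
under eq_fun do rewrite -ge0_sume_distrr //.
apply: cvgeZl => //; apply: measure_semi_sigma_additive.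
- by move=> k; exact: mpre.
- apply/trivIsetP => i j _ _ ij; rewrite !pre -preimage_setI.
  by move/trivIsetP : tF => /(_ i j Logic.I Logic.I ij) ->; rewrite preimage_set0.
- by rewrite (_ : \bigcup_k _ = [set: 'rV[R]_n] `*` \bigcup_k F k) ?pre ?preimage_bigcup;
    [rewrite -preimage_bigcup -pre; exact: mpre | apply: eq_bigcupr => k _; rewrite pre].
Qed.

HB.instance Definition _ := isMeasure.Build _ _ _ area_measure
  area_measure0 area_measure_ge0 area_measure_sigma_additive.

Let area_measure_fin : fin_num_fun area_measure.
Proof.
by move=> U mU; rewrite /area_measure fin_numM // fin_num_measure //; exact: mpre.
Qed.

HB.instance Definition _ := Measure_isFinite.Build _ _ _ area_measure
  area_measure_fin.

End area_measure.

(* For functions on S^(n-1), given by their values there. *)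
Definition lip_norm (R : realType) (n : nat) (f : 'rV[R]_n -> R) : \bar R :=
  ereal_sup [set (`|f ab.1 - f ab.2| / enorm (ab.1 - ab.2))%:E | ab in
    [set ab | [/\ usphere ab.1, usphere ab.2 & ab.1 <> ab.2]]].

Definition sup_norm (R : realType) (n : nat) (f : 'rV[R]_n -> R) : \bar R :=
  ereal_sup [set `|f a|%:E | a in @usphere R n].

Definition dbL (R : realType) (n : nat)
    (mu nu : {finite_measure set (vecB R n) -> \bar R}) : \bar R :=
  ereal_sup [set `| \int[mu]_(u in @usphere R n) (f u)%:E
                  - \int[nu]_(u in @usphere R n) (f u)%:E |%E
            | f in [set f : 'rV[R]_n -> R |
                (lip_norm f <= 1)%E /\ (sup_norm f <= 1)%E]].

(* Main.v *)
(* Wherever the distances of x to K and L are bounded below, the unit vectors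
   u_K(x) and u_L(x) differ by at most 6 sqrt delta, delta = d_H(K, L): the
   variational inequalities of the two projections give
   |p_K(x) - p_L(x)|^2 <= (d_K(x) + d_L(x)) delta.  Hence the points of the shell
   1 < d_K <= b whose direction u_K lies in omega belong to the slightly larger
   shell of L, with directions in the (6 sqrt delta)-neighbourhood of omega.  The
   measures of such shells are increments of the Steiner polynomial, which is
   Lipschitz in the radius, so enlarging the shell costs O(delta), and the
   coefficient kappa_1 Lambda_{n-1} is a fixed linear combination of n + 1 such
   increments.  Integrating over the levels of a Lipschitz test function f (with
   level step 6 sqrt delta, which absorbs the neighbourhood of omega in a shift
   by one level) gives the estimate.  Only monotonicity, subadditivity,
   additivity on separated sets and finiteness on balls of the Hausdorff outer
   measure are needed. *)
Require Import Defs.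
From HB Require Import structures.
From mathcomp Require Import all_boot all_order all_algebra.
From mathcomp Require Import all_classical all_reals all_analysis.
From mathcomp Require Import measurable_realfun.
From mathcomp Require Import ring lra.
Import Order.TTheory GRing.Theory Num.Theory.
Import numFieldNormedType.Exports.
Local Open Scope classical_set_scope.
Local Open Scope ring_scope.

Set Implicit Arguments.
Unset Strict Implicit.
Unset Printing Implicit Defensive.

(** * Euclidean geometry of parallel bodies *)

Definition dotp (R : realType) (n : nat) (x y : 'rV[R]_n) : R :=
  \sum_(i < n) x ord0 i * y ord0 i.

Section Euclid.
Variables (R : realType) (n : nat).
Implicit Types (x y z u v : 'rV[R]_n) (a b : R).

Lemma dotpC x y : dotp x y = dotp y x.
Proof. by apply: eq_bigr => i _; rewrite mulrC. Qed.

Lemma dotpDl x y z : dotp (x + y) z = dotp x z + dotp y z.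
Proof. by rewrite -big_split; apply: eq_bigr => i _; rewrite mxE mulrDl. Qed.

Lemma dotpZl a x z : dotp (a *: x) z = a * dotp x z.
Proof. by rewrite /dotp mulr_sumr; apply: eq_bigr => i _; rewrite mxE mulrA. Qed.

Lemma dotpDr x y z : dotp z (x + y) = dotp z x + dotp z y.
Proof. by rewrite dotpC dotpDl !(dotpC z). Qed.

Lemma dotpZr a x z : dotp z (a *: x) = a * dotp z x.
Proof. by rewrite dotpC dotpZl (dotpC z). Qed.

Lemma dotpNl x z : dotp (- x) z = - dotp x z.
Proof. by rewrite -scaleN1r dotpZl mulN1r. Qed.

Lemma dotpNr x z : dotp z (- x) = - dotp z x.
Proof. by rewrite -scaleN1r dotpZr mulN1r. Qed.

Lemma dotp_ge0 x : 0 <= dotp x x.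
Proof. by apply: sumr_ge0 => i _; rewrite -expr2 sqr_ge0. Qed.

Lemma enormE x : enorm x = Num.sqrt (dotp x x).
Proof. by congr Num.sqrt; apply: eq_bigr => i _; rewrite expr2. Qed.

Lemma enorm_ge0 x : 0 <= enorm x.
Proof. exact: sqrtr_ge0. Qed.

Lemma sqr_enorm x : enorm x ^+ 2 = dotp x x.
Proof. by rewrite enormE sqr_sqrtr ?dotp_ge0. Qed.

Lemma enormZ a x : enorm (a *: x) = `|a| * enorm x.
Proof.
by rewrite !enormE dotpZl dotpZr mulrA -expr2 sqrtrM ?sqr_ge0// sqrtr_sqr.
Qed.

Lemma enormN x : enorm (- x) = enorm x.
Proof. by rewrite -scaleN1r enormZ normrN1 mul1r. Qed.

Lemma enormB x y : enorm (x - y) = enorm (y - x).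
Proof. by rewrite -enormN opprB. Qed.

Lemma enorm0 : enorm (0 : 'rV[R]_n) = 0.
Proof. by rewrite -(scale0r (0 : 'rV[R]_n)) enormZ normr0 mul0r. Qed.

Lemma enorm_coord x i : `|x ord0 i| <= enorm x.
Proof.
rewrite -sqrtr_sqr ler_wsqrtr// (bigD1 i)//= lerDl.
by apply: sumr_ge0 => j _; rewrite sqr_ge0.
Qed.

Lemma enorm_eq0 x : enorm x = 0 -> x = 0.
Proof.
move=> x0; apply/rowP => i; rewrite mxE; apply/eqP.
by rewrite -normr_le0 -x0 enorm_coord.
Qed.

Lemma dotp_enorm x y : dotp x y <= enorm x * enorm y.
Proof.
have [y0|y0] := eqVneq (dotp y y) 0.
  have /enorm_eq0 -> : enorm y = 0 by rewrite enormE y0 sqrtr0.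
  by rewrite enorm0 mulr0 -(scale0r (0 : 'rV[R]_n)) dotpZr mul0r.
have yp : 0 < dotp y y by rewrite lt_neqAle eq_sym y0 dotp_ge0.
have := dotp_ge0 (dotp y y *: x - dotp x y *: y).
rewrite !(dotpDl, dotpDr, dotpNl, dotpNr, dotpZl, dotpZr) (dotpC y x) => H.
have {}H : 0 <= dotp y y * (dotp x x * dotp y y - dotp x y ^+ 2).
  by apply: le_trans H _; rewrite le_eqVlt; apply/orP; left; apply/eqP; ring.
rewrite pmulr_rge0// subr_ge0 in H.
apply: le_trans (ler_norm _) _.
by rewrite !enormE -sqrtrM ?dotp_ge0// -sqrtr_sqr ler_wsqrtr.
Qed.

Lemma enormD x y : enorm (x + y) <= enorm x + enorm y.
Proof.
rewrite -[leRHS]ger0_norm ?addr_ge0 ?enorm_ge0// -[leRHS]sqrtr_sqr.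
rewrite [leLHS]enormE ler_wsqrtr// sqrrD !sqr_enorm dotpDl !dotpDr (dotpC y x).
have := dotp_enorm x y; lra.
Qed.

Lemma enorm_triangle y x z : enorm (x - z) <= enorm (x - y) + enorm (y - z).
Proof. by apply: le_trans (enormD _ _); rewrite addrA subrK. Qed.

Lemma ler_dist_enorm x y : `|enorm x - enorm y| <= enorm (x - y).
Proof.
have := enorm_triangle y x 0; have := enorm_triangle x y 0.
rewrite !subr0 (enormB y x) => h1 h2.
by rewrite ler_norml; apply/andP; split; lra.
Qed.

Lemma enorm_continuous : continuous (@enorm R n).
Proof.
move=> x; apply: (@continuous_comp _ _ _ (fun x : 'rV[R]_n => _) Num.sqrt).
  move: x; apply: continuous_big => [|i _ x]; first exact: add_continuous.
  apply: (@continuous_comp _ _ _ (fun x => x ord0 i) (fun t : R => t ^+ 2)).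
    exact: coord_continuous.
  exact: exprn_continuous.
exact: sqrt_continuous.
Qed.

Lemma enormB_continuous y : continuous (fun x => enorm (x - y)).
Proof.
move=> x; apply: (@continuous_comp _ _ _ (fun x => x - y) (@enorm R n)).
  apply: (@continuousB _ _ _ id (cst y)); [exact: cvg_id|exact: cst_continuous].
exact: enorm_continuous.
Qed.

Lemma open_eball y (r : R) : open [set x | enorm (x - y) < r].
Proof.
rewrite (_ : mkset _ = (fun x => enorm (x - y)) @^-1` [set t | t < r])//.
by apply: open_comp; [move=> x _; exact: enormB_continuous|exact: open_lt].
Qed.

Lemma closed_usphere : closed (@usphere R n).
Proof.
rewrite (_ : @usphere R n = @enorm R n @^-1` [set 1])//.
apply: closed_comp => [x _|]; first exact: enorm_continuous.
exact: closed_eq.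
Qed.

Lemma parallelP (K : set 'rV[R]_n) rho x : 0 < rho ->
  parallel K rho x <-> exists2 a, K a & enorm (x - a) <= rho.
Proof.
move=> r0; split=> [[a Ka [b]]|[a Ka xa]].
  rewrite /unit_ball /cball /= subr0 => b1 <-; exists a => //.
  by rewrite addrC addKr enormZ gtr0_norm// ler_piMr// ltW.
exists a => //; exists (rho^-1 *: (x - a)).
  rewrite /unit_ball /cball /= subr0 enormZ gtr0_norm ?invr_gt0//.
  by rewrite mulrC ler_pdivrMr// mul1r.
by rewrite scalerA divff ?gt_eqF// scale1r addrC subrK.
Qed.

Lemma parallel_le (K : set 'rV[R]_n) rho x : 0 <= rho ->
  parallel K rho x -> exists2 a, K a & enorm (x - a) <= rho.
Proof.
move=> r0 [a Ka [b]]; rewrite /unit_ball /cball /= subr0 => b1 <-; exists a => //.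
by rewrite addrC addKr enormZ ger0_norm// ler_piMr.
Qed.

Lemma sub_parallel (K : set 'rV[R]_n) rho : K `<=` parallel K rho.
Proof.
move=> x Kx; exists x => //; exists 0; last by rewrite scaler0 addr0.
by rewrite /unit_ball /cball /= subrr enorm0.
Qed.

Section nearest.
Variables (K : set 'rV[R]_n) (cK : convex_body K).
Local Notation p := (nearest_pt K).

(** Compactness gives a minimiser of the distance, and [xget] returns a witness as soon as one
    exists, so its default value 0 is never taken. *)
Lemma nearest_ptP x : K (p x) /\ forall z, K z -> enorm (x - p x) <= enorm (x - z).
Proof.
case: cK => K0 Kc _.
have [|c cA hc] := @EVT_min_rV R n (fun y => enorm (y - x)) K K0 Kc.
  apply: continuous_subspaceT; exact: enormB_continuous.
have : [set y | K y /\ forall z, K z -> enorm (x - y) <= enorm (x - z)] c.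
  split; first by rewrite inE in cA.
  by move=> z Kz; rewrite !(enormB x); apply: hc; rewrite inE.
by move=> Hc; exact: (xgetPex 0 (ex_intro _ c Hc)).
Qed.

Lemma dist_to_le x z : K z -> dist_to K x <= enorm (x - z).
Proof. exact: (nearest_ptP x).2. Qed.

Lemma dist_to_ge0 x : 0 <= dist_to K x.
Proof. exact: enorm_ge0. Qed.

Lemma dist_to_in x : K x -> dist_to K x = 0.
Proof.
move=> Kx; apply/eqP; rewrite eq_le dist_to_ge0 andbT.
by apply: le_trans (dist_to_le x Kx) _; rewrite subrr enorm0.
Qed.

Lemma parallel_dist rho x : 0 < rho -> parallel K rho x <-> dist_to K x <= rho.
Proof.
move=> r0; rewrite parallelP//; split=> [[a Ka xa]|h].
  exact: le_trans (dist_to_le x Ka) xa.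
by exists (p x) => //; exact: (nearest_ptP x).1.
Qed.

Lemma dist_to_lip x y : dist_to K x <= enorm (x - y) + dist_to K y.
Proof.
by apply: le_trans (dist_to_le x (nearest_ptP y).1) _; exact: enorm_triangle.
Qed.

(** If the product [a] were positive, a short move from [p x] towards [z] would stay in [K] by
    convexity and change the squared distance by [t * (t * b - 2 * a) < 0]. *)
Lemma nearest_pt_dotp x z : K z -> dotp (x - p x) (z - p x) <= 0.
Proof.
move=> Kz; rewrite leNgt; apply/negP => h.
have [Kp Hp] := nearest_ptP x.
set a := dotp _ _ in h; set b := dotp (z - p x) (z - p x).
have b0 : 0 <= b by exact: dotp_ge0.
(* This choice gives both [t <= 1] and [t * b < 2 * a], also when [b = 0]. *)
pose t := a / (a + b).
have t0 : 0 < t by rewrite divr_gt0// ltr_wpDr.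
have t1 : t <= 1 by rewrite ler_pdivrMr ?ltr_wpDr// mul1r lerDl.
have tb : t * b < 2 * a.
  rewrite /t mulrAC ltr_pdivrMr ?ltr_wpDr//.
  have : 0 < a * a by rewrite mulr_gt0. have : 0 <= a * b by rewrite mulr_ge0 // ltW.
  lra.
have Kt : K (p x + t *: (z - p x)).
  case: cK => _ _ /(_ z (p x) (Itv01 (ltW t0) t1)).
  rewrite !inE => /(_ Kz Kp).
  congr K; apply/rowP => i; rewrite /conv /= !mxE /=.
  by rewrite /unstable.onem; ring.
have := Hp _ Kt; rewrite opprD addrA.
rewrite -(@ler_pXn2r _ 2) ?nnegrE ?enorm_ge0// !sqr_enorm.
rewrite [leRHS](_ : _ = dotp (x - p x) (x - p x) + t * (t * b - 2 * a)); last first.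
  rewrite /a /b !(dotpDl, dotpDr, dotpNl, dotpNr, dotpZl, dotpZr).
  by rewrite (dotpC z x) (dotpC (p x) x) (dotpC (p x) z); ring.
rewrite lerDl pmulr_rge0// subr_ge0; lra.
Qed.

Lemma outer_dir_sphere x : 0 < dist_to K x -> usphere (outer_dir K x).
Proof.
by move=> d0; rewrite /usphere /= enormZ gtr0_norm ?invr_gt0// mulVf// gt_eqF.
Qed.

End nearest.

Section two_bodies.
Variables (K L : set 'rV[R]_n) (cK : convex_body K) (cL : convex_body L).
Variables (delta : R) (d0 : 0 <= delta).
Hypothesis KL : K `<=` parallel L delta.
Hypothesis LK : L `<=` parallel K delta.

Lemma dist_to_hausdorff x : dist_to L x <= dist_to K x + delta.
Proof.
have [y Ly py] := parallel_le d0 (KL (nearest_ptP cK x).1).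
apply: le_trans (dist_to_le cL x Ly) _.
by apply: le_trans (enorm_triangle (nearest_pt K x) _ _) _; rewrite lerD2l.
Qed.

(* Test the variational inequality of each projection against a point of that
   body at distance at most delta from the other projection. *)
Lemma nearest_pt_hausdorff x :
  enorm (nearest_pt K x - nearest_pt L x) ^+ 2 <= (dist_to K x + dist_to L x) * delta.
Proof.
set p := nearest_pt K x; set q := nearest_pt L x.
have [y Ly py] := parallel_le d0 (KL (nearest_ptP cK x).1).
have [w Kw qw] := parallel_le d0 (LK (nearest_ptP cL x).1).
have h1 := nearest_pt_dotp cK x Kw; have h2 := nearest_pt_dotp cL x Ly.
rewrite -/p -/q in h1 h2 py qw.
have e1 : dotp (x - p) (q - w) <= dist_to K x * delta.
  by apply: le_trans (dotp_enorm _ _) _; rewrite ler_wpM2l ?dist_to_ge0.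
have e2 : dotp (x - q) (p - y) <= dist_to L x * delta.
  by apply: le_trans (dotp_enorm _ _) _; rewrite ler_wpM2l ?dist_to_ge0.
rewrite sqr_enorm.
move: h1 h2 e1 e2; rewrite !(dotpDl, dotpDr, dotpNl, dotpNr).
rewrite (dotpC p q); lra.
Qed.

(** With [p], [q] the two projections, the difference of directions is [(q - p) + (d_L - d_K) u_L]
    divided by [d_K >= 1]. Both summands have norm at most [|p - q|], hence twice
    [3 * sqrt delta]. *)
Lemma outer_dir_hausdorff x : delta <= 1 -> 1 <= dist_to K x <= 2 ->
  0 < dist_to L x ->
  enorm (outer_dir K x - outer_dir L x) <= 6 * Num.sqrt delta.
Proof.
move=> d1 /andP[dK1 dK2] dL0.
have h1 := dist_to_hausdorff x.
have pq : enorm (nearest_pt K x - nearest_pt L x) <= 3 * Num.sqrt delta.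
  rewrite -(@ler_pXn2r _ 2) ?nnegrE ?enorm_ge0 ?mulr_ge0 ?sqrtr_ge0//.
  apply: le_trans (nearest_pt_hausdorff x) _.
  (* Here [d_K <= 2] and [d_L <= 3], so the sum of the distances is below 9. *)
  rewrite exprMn sqr_sqrtr// ler_wpM2r//; lra.
have h2 := ler_dist_enorm (x - nearest_pt L x) (x - nearest_pt K x).
rewrite opprB [X in _ <= enorm X]addrC addrA subrK in h2.
have dKN0 : dist_to K x != 0 by rewrite gt_eqF//; lra.
have dLN0 : dist_to L x != 0 by rewrite gt_eqF.
have -> : outer_dir K x - outer_dir L x = (dist_to K x)^-1 *:
    ((nearest_pt L x - nearest_pt K x) +
     ((dist_to L x - dist_to K x) / dist_to L x) *: (x - nearest_pt L x)).
  apply/rowP => i; rewrite !mxE; field.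
  by rewrite dLN0.
rewrite enormZ ger0_norm ?invr_ge0 ?dist_to_ge0//.
rewrite mulrC ler_pdivrMr; last by lra.
apply: le_trans (enormD _ _) _.
rewrite enormZ normrM normfV (gtr0_norm dL0) -/(dist_to L x) divfK//.
rewrite enormB; move: h2; rewrite -/(dist_to L x) -/(dist_to K x) => h2.
have s0 := sqrtr_ge0 delta.
have : 6 * Num.sqrt delta <= 6 * Num.sqrt delta * dist_to K x by rewrite ler_peMr// mulr_ge0.
lra.
Qed.

End two_bodies.
End Euclid.

(** * The Hausdorff outer measure *)

Section ereal_inf_sup.
Local Open Scope ereal_scope.
Variable R : realType.
Implicit Types (S T : set (\bar R)) (c t : \bar R).

(** For finite [t] the term moves to the other side of the inequality; for [t = +oo] nonnegativity
    of the infimum makes the right side [+oo]. *)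
Lemma le_ereal_infDl S t c : (forall s, S s -> 0 <= s) -> 0 <= t ->
  (forall s, S s -> c <= s + t) -> c <= ereal_inf S + t.
Proof.
move=> S0 t0 H.
have i0 : 0 <= ereal_inf S by apply: le_ereal_inf_tmp.
case: t t0 H => [t| |] // t0 H; last first.
  by rewrite addey ?leey// gt_eqF// (lt_le_trans _ i0).
by rewrite -leeBlDr//; apply: le_ereal_inf_tmp => s Ss; rewrite leeBlDr// H.
Qed.

Lemma le_ereal_infD S T c : (forall s, S s -> 0 <= s) -> (forall t, T t -> 0 <= t) ->
  (forall s t, S s -> T t -> c <= s + t) -> c <= ereal_inf S + ereal_inf T.
Proof.
move=> S0 T0 H; apply: le_ereal_infDl => //; first by apply: le_ereal_inf_tmp.
move=> s Ss; rewrite addeC; apply: le_ereal_infDl => //; first exact: S0.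
by move=> t Tt; rewrite addeC; apply: H.
Qed.

(** When [t = +oo], one element of [S] already forces [c = +oo]; otherwise [t] is subtracted. *)
Lemma ereal_supD_leDl S t c : S !=set0 -> (forall s, S s -> 0 <= s) -> 0 <= t ->
  (forall s, S s -> s + t <= c) -> ereal_sup S + t <= c.
Proof.
move=> [s0 Ss0] S0 t0 H; case: t t0 H => [t| |] // t0 H; last first.
  have := H _ Ss0; rewrite addey ?gt_eqF// ?(lt_le_trans _ (S0 _ Ss0))//.
  by rewrite leye_eq => /eqP ->; rewrite leey.
by rewrite -leeBrDr//; apply: ge_ereal_sup => s Ss; rewrite leeBrDr// H.
Qed.

Lemma ereal_supD_le S T c : S !=set0 -> T !=set0 ->
  (forall s, S s -> 0 <= s) -> (forall t, T t -> 0 <= t) ->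
  (forall s t, S s -> T t -> s + t <= c) -> ereal_sup S + ereal_sup T <= c.
Proof.
move=> SN [t1 Tt1] S0 T0 H; apply: ereal_supD_leDl => //.
  by apply: le_trans (T0 _ Tt1) _; exact: ereal_sup_ubound.
move=> s Ss; rewrite addeC; apply: ereal_supD_leDl => //; first by exists t1.
- exact: S0.
- by move=> t Tt; rewrite addeC; apply: H.
Qed.

(** A partial sum of length [m] is at most the one of length [2m], which splits exactly into its
    even and odd terms. This prices the merging of two covers into one sequence. *)
Lemma nneseries_interleave (f g : nat -> \bar R) :
  (forall k, 0 <= f k) -> (forall k, 0 <= g k) ->
  \sum_(0 <= k <oo) (if odd k then g k./2 else f k./2) <=
  \sum_(0 <= k <oo) f k + \sum_(0 <= k <oo) g k.
Proof.
move=> f0 g0; have h0 k : 0 <= (if odd k then g k./2 else f k./2) by case: ifP.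
apply: lime_le; first exact: is_cvg_nneseries.
near=> m; apply: (@le_trans _ _ (\sum_(0 <= k < m.*2) (if odd k then g k./2 else f k./2))).
  rewrite [leRHS](big_cat_nat (n := m))//=; last by rewrite -addnn leq_addr.
  by rewrite leeDl// sume_ge0.
have -> : \sum_(0 <= k < m.*2) (if odd k then g k./2 else f k./2) =
    \sum_(0 <= k < m) f k + \sum_(0 <= k < m) g k.
  elim: (m) => [|j IH]; first by rewrite !big_geq// adde0.
  rewrite doubleS !big_nat_recr//= IH odd_double/= uphalf_double doubleK.
  by rewrite addeACA addeA.
by rewrite leeD// nneseries_lim_ge.
Unshelve. all: by end_near. Qed.

Lemma nneseries_finsupp (f : nat -> \bar R) (c : R) N :
  (forall k, 0 <= f k) -> (forall k, f k <= c%:E) -> (forall k, (N <= k)%N -> f k = 0) ->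
  \sum_(0 <= k <oo) f k <= (N%:R * c)%:E.
Proof.
move=> f0 fc fN; rewrite (nneseries_split _ N)//=.
rewrite [X in _ + X]eseries0 ?adde0; last by move=> k; rewrite add0n => Nk _; exact: fN.
rewrite add0n; apply: (@le_trans _ _ (\sum_(0 <= k < N) c%:E)).
  by apply: lee_sum => k _; exact: fc.
by rewrite sumEFin big_const_nat subn0 iter_addr_0 mulr_natl.
Qed.

End ereal_inf_sup.

Section Hausdorff.
Variables (R : realType) (n : nat).
Implicit Types (A B : set 'rV[R]_n).
Local Open Scope ereal_scope.

Lemma kappa_ge0 : (0 <= kappa R n)%R.
Proof.
apply: fine_ge0; apply: le_ereal_inf_tmp => _ [a [b [ab _ ->]]].
apply: nneseries_ge0 => k _ _; rewrite lee_fin.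
by apply: prodr_ge0 => i _; rewrite subr_ge0 ab.
Qed.

Definition hweight A : R := kappa R n * (fine (ediam A) / 2) ^+ n.

Lemma ediam_ub A x y : A x -> A y -> (enorm (x - y))%:E <= ediam A.
Proof. by move=> Ax Ay; apply: ereal_sup_ubound; exists x => //; exists y. Qed.

Lemma ediam0 : ediam (set0 : set 'rV[R]_n) = -oo.
Proof.
rewrite -[RHS]ereal_sup0; congr ereal_sup.
by apply/seteqP; split=> // t [x []].
Qed.

Lemma ediam_le A (d : R) : (forall x y, A x -> A y -> (enorm (x - y) <= d)%R) ->
  ediam A <= d%:E.
Proof.
by move=> H; apply: ge_ereal_sup => _ [x Ax [y Ay <-]]; rewrite lee_fin H.
Qed.

Lemma fine_ediam_ge0 A : (0 <= fine (ediam A))%R.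
Proof.
have [->|/set0P[x Ax]] := eqVneq A set0; first by rewrite ediam0.
apply: fine_ge0; apply: le_trans (ediam_ub Ax Ax).
by rewrite lee_fin enorm_ge0.
Qed.

Lemma hweight_ge0 A : (0 <= hweight A)%R.
Proof. by rewrite mulr_ge0 ?kappa_ge0// exprn_ge0// divr_ge0// fine_ediam_ge0. Qed.

Lemma hweight0 : (0 < n)%N -> hweight set0 = 0%R.
Proof. by move=> n0; rewrite /hweight ediam0 /= mul0r expr0n gtn_eqF// mulr0. Qed.

Lemma hausdorff_pre_le delta A (F : nat -> set 'rV[R]_n) :
  (forall k, ediam (F k) <= delta%:E) -> A `<=` \bigcup_k F k ->
  hausdorff_pre delta A <= \sum_(0 <= k <oo) (hweight (F k))%:E.
Proof. by move=> h1 h2; apply: ereal_inf_lbound; exists F. Qed.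

Lemma hausdorff_pre_ge0 delta A : 0 <= hausdorff_pre delta A.
Proof.
apply: le_ereal_inf_tmp => _ [F _ <-]; apply: nneseries_ge0 => k _ _.
by rewrite lee_fin hweight_ge0.
Qed.

Lemma hausdorff_pre_subset delta A B : A `<=` B ->
  hausdorff_pre delta A <= hausdorff_pre delta B.
Proof.
move=> AB; apply: ereal_inf_le_tmp => _ [F [Fd BF] <-]; exists F => //.
by split=> //; exact: subset_trans BF.
Qed.

Lemma hausdorff_pre_antitone (d1 d2 : R) A : (d1 <= d2)%R ->
  hausdorff_pre d2 A <= hausdorff_pre d1 A.
Proof.
move=> d12; apply: ereal_inf_le_tmp => _ [F [Fd AF] <-]; exists F => //.
by split=> // k; apply: le_trans (Fd k) _; rewrite lee_fin.
Qed.

Lemma hausdorff_pre_le_measure (delta : R) A : (0 < delta)%R ->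
  hausdorff_pre delta A <= hausdorff_measure A.
Proof. by move=> d0; apply: ereal_sup_ubound; exists delta. Qed.

Lemma hausdorff_measure_subset A B : A `<=` B ->
  hausdorff_measure A <= hausdorff_measure B.
Proof.
move=> AB; apply: ge_ereal_sup => _ [d d0 <-].
exact: le_trans (hausdorff_pre_subset _ AB) (hausdorff_pre_le_measure _ d0).
Qed.

(** At a fixed scale, a cover of [A] on the even indices and a cover of [B] on the odd ones form a
    cover of the union. *)
Lemma hausdorff_measureU A B :
  hausdorff_measure (A `|` B) <= hausdorff_measure A + hausdorff_measure B.
Proof.
apply: ge_ereal_sup => _ [d d0 <-].
apply: (@le_trans _ _ (hausdorff_pre d A + hausdorff_pre d B)); last first.
  by rewrite leeD// hausdorff_pre_le_measure.
have w0 (F : nat -> set 'rV[R]_n) k : 0 <= (hweight (F k))%:E by rewrite lee_fin hweight_ge0.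
apply: le_ereal_infD => [_ [F _ <-]|_ [F _ <-]|_ _ [F [Fd AF] <-] [G [Gd BG] <-]].
- by apply: nneseries_ge0 => k _ _; exact: w0.
- by apply: nneseries_ge0 => k _ _; exact: w0.
- apply: le_trans (nneseries_interleave (w0 F) (w0 G)).
  apply: le_trans (@hausdorff_pre_le d _ (fun k => if odd k then G k./2 else F k./2) _ _) _.
  + by move=> k; case: ifP.
  + move=> x [/AF[k _ Fx]|/BG[k _ Gx]].
      by exists k.*2 => //=; rewrite odd_double doubleK.
    by exists k.*2.+1 => //=; rewrite odd_double /= uphalf_double.
  + by apply: lee_nneseries => [k _ _|k _]; [exact: (w0 (fun k => if _ then _ else _))|case: ifP].
Qed.

(** A set of diameter at most [s] cannot meet both [A] and [B]. Hence, at scales up to [s], a cover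
    of the union splits into two covers without extra weight. *)
Lemma hausdorff_measure_separated A B (s : R) : (0 < n)%N -> (0 < s)%R ->
  (forall x y, A x -> B y -> (s < enorm (x - y))%R) ->
  hausdorff_measure A + hausdorff_measure B <= hausdorff_measure (A `|` B).
Proof.
move=> n0 s0 AB.
have pre_le d : (d <= s)%R ->
    hausdorff_pre d A + hausdorff_pre d B <= hausdorff_pre d (A `|` B).
  move=> ds; apply: le_ereal_inf_tmp => _ [F [Fd ABF] <-].
  (* [G C] keeps the pieces that meet [C] and empties the others; emptied pieces have weight 0
     because [n > 0]. *)
  pose G (C : set 'rV[R]_n) k := [set x | F k x /\ F k `&` C !=set0].
  have GE C k : F k `&` C !=set0 -> G C k = F k.
    by move=> h; apply/seteqP; split=> x // [].
  have G0 C k : ~ (F k `&` C !=set0) -> G C k = set0.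
    by move=> h; apply/seteqP; split=> x // [].
  have Gd C k : ediam (G C k) <= d%:E.
    by case: (pselect (F k `&` C !=set0)) => h; [rewrite GE|rewrite G0// ediam0 leNye].
  have Gcov C : C `<=` A `|` B -> C `<=` \bigcup_k G C k.
    by move=> CAB x Cx; have [k _ Fx] := ABF _ (CAB _ Cx); exists k => //; split=> //; exists x.
  have w0 (H : nat -> set 'rV[R]_n) k : 0 <= (hweight (H k))%:E by rewrite lee_fin hweight_ge0.
  apply: (@le_trans _ _ (\sum_(0 <= k <oo) ((hweight (G A k))%:E + (hweight (G B k))%:E))).
    rewrite nneseriesD//; try by move=> k _ _; apply: w0.
    by apply: leeD; apply: hausdorff_pre_le => //; apply: Gcov => x; [left|right].
  apply: lee_nneseries => [k _ _|k _]; first by apply: adde_ge0; exact: w0.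
  case: (pselect (F k `&` A !=set0)) => hA; last first.
    rewrite (G0 A)// hweight0// add0e.
    by case: (pselect (F k `&` B !=set0)) => hB; [rewrite GE|rewrite G0// hweight0//; exact: w0].
  rewrite (GE A)//; rewrite G0 ?hweight0 ?adde0//.
  case: hA => x [Fx Ax] [y [Fy By]].
  have := le_trans (ediam_ub Fx Fy) (Fd k); rewrite lee_fin => h.
  by have := lt_le_trans (AB _ _ Ax By) (le_trans h ds); rewrite ltxx.
apply: ereal_supD_le => [||_ [d _ <-]|_ [d _ <-]|_ _ [d1 d10 <-] [d2 d20 <-]].
- by exists (hausdorff_pre 1 A); exists 1%R => //=.
- by exists (hausdorff_pre 1 B); exists 1%R => //=.
- exact: hausdorff_pre_ge0.
- exact: hausdorff_pre_ge0.
(* The two suprema range over independent scales; passing to a common smaller scale only increases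
   both pre-measures. *)
pose d := Num.min s (Num.min d1 d2).
apply: (@le_trans _ _ (hausdorff_pre d A + hausdorff_pre d B)).
  by apply: leeD; apply: hausdorff_pre_antitone; rewrite !ge_min lexx ?orbT.
apply: le_trans (pre_le _ _) _; first by rewrite ge_min lexx.
by apply: hausdorff_pre_le_measure; rewrite !lt_min s0 d10 d20.
Qed.

End Hausdorff.

(** * Measure of balls and the value of [kappa R 1] *)

Section ball_bound.
Variables (R : realType) (n : nat).

Lemma enorm_le_coord (x : 'rV[R]_n) (h : R) : 0 <= h ->
  (forall i, `|x ord0 i| <= h) -> enorm x <= Num.sqrt n%:R * h.
Proof.
move=> h0 H; rewrite -[X in _ * X]ger0_norm// -sqrtr_sqr -sqrtrM ?ler0n//.
apply: ler_wsqrtr; apply: le_trans (_ : \sum_(i < n) h ^+ 2 <= _).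
  by apply: ler_sum => i _; rewrite -[_ ^+ 2]real_normK ?num_real// ler_pXn2r ?nnegrE.
by rewrite sumr_const card_ord mulr_natl.
Qed.

Lemma exists_ord_itv (m : nat) (t : R) : (0 < m)%N -> 0 <= t <= m%:R ->
  exists i : 'I_m, i%:R <= t <= i.+1%:R.
Proof.
(* The endpoint [t = m] goes to the last cell, since its integer part is out of range. *)
move=> m0 /andP[t0]; rewrite le_eqVlt => /predU1P[->|tm].
  have h : (m.-1 < m)%N by rewrite prednK.
  by exists (Ordinal h) => /=; rewrite !ler_nat prednK// leq_pred leqnn.
have h : (Num.trunc t < m)%N by rewrite Num.Theory.truncn_lt_nat.
exists (Ordinal h) => /=; have /andP[-> /ltW ->] := Num.Theory.truncn_itv t0.
by [].
Qed.

(* Cover by m^n cubes of side 2r/m: the sum does not depend on m. *)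
Lemma hausdorff_measure_cball (z : 'rV[R]_n) (r : R) : (0 < n)%N -> 0 < r ->
  (hausdorff_measure (cball z r) <= (kappa R n * (Num.sqrt n%:R * r) ^+ n)%:E)%E.
Proof.
move=> n0 r0; apply: ge_ereal_sup => _ [d d0 <-].
pose q : R := Num.sqrt n%:R * (2 * r).
have q0 : 0 <= q by rewrite mulr_ge0 ?sqrtr_ge0 ?mulr_ge0 ?ltW.
(* Large enough for the cell diameter [q / m] to be at most the scale [d]. *)
pose m := (Num.trunc (q / d)).+1.
have mR0 : 0 < m%:R :> R by rewrite ltr0n.
pose h : R := 2 * r / m%:R.
have h0 : 0 < h by rewrite divr_gt0 ?mulr_gt0.
have hd : Num.sqrt n%:R * h <= d.
  rewrite /h mulrA ler_pdivrMr// [d * _]mulrC -ler_pdivrMr//.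
  by rewrite ltW// (@Num.Theory.truncnS_gt).
pose T := {ffun 'I_n -> 'I_m}.
pose lo (f : T) : 'rV[R]_n := \row_i (z ord0 i - r + h * (f i)%:R).
pose hi (f : T) : 'rV[R]_n := \row_i (z ord0 i - r + h * (f i).+1%:R).
(* The cells are enumerated and padded with empty sets, since covers are sequences. *)
pose F (k : nat) : set 'rV[R]_n :=
  if insub k is Some i then box (lo (@enum_val T predT i)) (hi (enum_val i)) else set0.
have Fd k : (ediam (F k) <= (Num.sqrt n%:R * h)%:E)%E.
  rewrite /F; case: insubP => [i _ _|_]; last by rewrite ediam0 leNye.
  apply: ediam_le => x y bx bY; apply: enorm_le_coord; first exact: ltW.
  move=> j; have := bx j; have := bY j; rewrite !mxE -[(_.+1)%:R]natr1.
  move: (_%:R) => a; rewrite mulrDr mulr1 => /andP[u1 u2] /andP[v1 v2].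
  by rewrite ler_norml; apply/andP; split; lra.
have Fout k : (#|T| <= k)%N -> F k = set0.
  by move=> h1; rewrite /F insubF// ltnNge h1.
have Fw k : hweight (F k) <= kappa R n * (Num.sqrt n%:R * h / 2) ^+ n.
  have sh0 : 0 <= Num.sqrt n%:R * h by rewrite mulr_ge0 ?sqrtr_ge0 ?ltW.
  rewrite ler_wpM2l ?kappa_ge0//; apply: lerXn2r; rewrite ?nnegrE.
  - by rewrite divr_ge0 ?fine_ediam_ge0.
  - by rewrite divr_ge0.
  - rewrite ler_wpM2r ?invr_ge0//; have := Fd k.
    by case: (ediam (F k)).
apply: le_trans (@hausdorff_pre_le _ _ d _ F _ _) _.
- by move=> k; apply: le_trans (Fd k) _; rewrite lee_fin.
- move=> x xz.
  have /choice[f fP] : forall j : 'I_n, exists i : 'I_m,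
      i%:R <= (x ord0 j - z ord0 j + r) / h <= i.+1%:R.
    move=> j; apply: exists_ord_itv => //.
    have := le_trans (enorm_coord (x - z) j) xz; rewrite !mxE ler_norml => /andP[x1 x2].
    apply/andP; split; first by apply: divr_ge0; [lra|exact: ltW].
    rewrite ler_pdivrMr// /h mulrC divfK ?gt_eqF//; lra.
  exists (enum_rank (finfun f : T)) => //; rewrite /F.
  rewrite insubT //= => lt_; rewrite (_ : Sub _ _ = enum_rank (finfun f : T)); last exact: val_inj.
  rewrite enum_rankK => j; rewrite !mxE !ffunE.
  have := fP j; rewrite ler_pdivlMr// ler_pdivrMr// ![_ * h]mulrC => /andP[x1 x2].
  by apply/andP; split; lra.
- apply: le_trans (nneseries_finsupp
    (c := kappa R n * (Num.sqrt n%:R * h / 2) ^+ n) (N := #|T|) _ _ _) _.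
  + by move=> k; rewrite lee_fin hweight_ge0.
  + by move=> k; rewrite lee_fin.
  + by move=> k /Fout ->; rewrite hweight0.
  + rewrite lee_fin card_ffun !card_ord natrX mulrCA -exprMn.
    rewrite (_ : m%:R * _ = Num.sqrt n%:R * r)//.
    by rewrite /h; field; rewrite gt_eqF.
Qed.

End ball_bound.

(** This makes the divisor [kappa R 1] positive. The lower bound reads one-dimensional boxes as
    intervals and uses subadditivity of Lebesgue measure; the upper one uses a single box padded
    with degenerate ones. *)
Lemma lebesgue_outer_unit_ball1 (R : realType) :
  (2%:E <= lebesgue_outer (@unit_ball R 1) <= 2%:E)%E.
Proof.
apply/andP; split.
  apply: le_ereal_inf_tmp => _ [a [b [ab cov ->]]].
  pose F k : set R := [set` `[a k ord0 ord0, b k ord0 ord0]].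
  have H : [set` `[(-1)%R, 1%R]] `<=` \bigcup_k F k ->
      (lebesgue_measure ([set` `[(-1)%R, 1%R]] : set R) <=
       \sum_(0 <= k <oo) lebesgue_measure (F k))%E.
    move=> h; apply: (measure_sigma_subadditive (@lebesgue_measure R)) h.
      by move=> k; exact: measurable_itv.
    exact: measurable_itv.
  move: H; rewrite lebesgue_measure_itv /= lte_fin (_ : (-1 < 1 :> R)%R)/=; last lra.
  rewrite -EFinD opprK => H; apply: le_trans (H _) _.
  - move=> t; rewrite /= in_itv/= => /andP[t1 t2].
    have /cov[k _ /(_ ord0)] : @unit_ball R 1 (const_mx t).
      rewrite /unit_ball /cball /= subr0 /enorm big_ord1 mxE sqrtr_sqr.
      by rewrite ler_norml t1 t2.
    by rewrite mxE => h; exists k => //=; rewrite in_itv.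
  - apply: lee_nneseries => // k _; rewrite big_ord1 lebesgue_measure_itv /= lte_fin.
    by case: ifPn => // _; rewrite lee_fin subr_ge0.
apply: ereal_inf_lbound; exists (fun k => if k is 0%N then const_mx (-1) else 0).
exists (fun k => if k is 0%N then const_mx 1 else 0); split.
- by move=> [|k] i /=; rewrite !mxE ?lexx // lerN10.
- move=> x; rewrite /unit_ball /cball /= subr0 /enorm big_ord1 sqrtr_sqr ler_norml => h.
  by exists 0%N => // i; rewrite /= !mxE (ord1 i).
- rewrite (nneseries_split _ 1)//=; last first.
    move=> k _; rewrite big_ord1 lee_fin; case: k => [|k]; rewrite !mxE; lra.
  rewrite eseries0 => [|[|k] // _ _]; last by rewrite big_ord1 !mxE subrr.
  by rewrite adde0 add0n big_nat1 big_ord1 !mxE opprK.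
Qed.

Lemma kappa1_gt0 (R : realType) : 0 < kappa R 1.
Proof.
have /le_anti h := lebesgue_outer_unit_ball1 R.
by rewrite /kappa -h.
Qed.

(** * Steiner polynomials *)

Lemma subXX_le (R : realFieldType) (s t : R) m : 0 <= s <= t -> t <= 2 ->
  t ^+ m - s ^+ m <= m%:R * 2 ^+ m * (t - s).
Proof.
move=> /andP[s0 st] t2; elim: m => [|m IH]; first by rewrite !expr0; lra.
have -> : t ^+ m.+1 - s ^+ m.+1 = t * (t ^+ m - s ^+ m) + s ^+ m * (t - s).
  by rewrite !exprS; ring.
have sm : s ^+ m * (t - s) <= 2 ^+ m.+1 * (t - s).
  rewrite ler_wpM2r ?subr_ge0//; apply: le_trans (_ : 2 ^+ m <= _).
    by rewrite lerXn2r ?nnegrE//; lra.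
  by rewrite ler_eXn2l//; lra.
have tm : t * (t ^+ m - s ^+ m) <= 2 * (m%:R * 2 ^+ m * (t - s)).
  apply: ler_pM => //; [lra|rewrite subr_ge0 lerXn2r ?nnegrE//; lra].
rewrite -natr1; move: sm tm; rewrite exprS; lra.
Qed.

(* The weights c read off the linear coefficient of a polynomial of degree at
   most n from its values at the nodes; m = 0 says that they sum to 0. *)
Lemma steiner_nodes (R : realFieldType) (n : nat) :
  exists c rho : 'I_n.+1 -> R, (forall j, 1 <= rho j <= 3 / 2) /\
  forall m, (m <= n)%N -> \sum_j c j * rho j ^+ m = (m == 1%N)%:R.
Proof.
(* Distinct nodes make the Vandermonde matrix invertible; keeping them below 3/2 leaves room to
   enlarge a radius and stay below 2. *)
pose a : 'rV[R]_n.+1 := \row_j (1 + j%:R / (2 * n.+1%:R)).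
pose V := Vandermonde n.+1 a.
have Vu : V \in unitmx.
  rewrite unitmxE unitfE det_Vandermonde; apply/prodf_neq0 => i _.
  apply/prodf_neq0 => j ij; rewrite !mxE subr_eq0; apply/eqP => /addrI h.
  have := mulIf _ h; rewrite invr_neq0 ?mulf_neq0 ?pnatr_eq0// => /(_ isT) /eqP.
  by rewrite eqr_nat => /eqP ji; rewrite ji ltnn in ij.
pose e : 'cV[R]_n.+1 := \col_i (i == 1%N :> nat)%:R.
exists (fun j => (invmx V *m e) j ord0), (fun j => a ord0 j); split=> [j|m mn].
  rewrite mxE; have n0 : 0 < n.+1%:R :> R by rewrite ltr0n.
  have jn : j%:R <= n.+1%:R :> R by rewrite ler_nat ltnW.
  have q0 : 0 <= j%:R / (2 * n.+1%:R) :> R by rewrite divr_ge0 ?mulr_ge0.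
  have q1 : j%:R / (2 * n.+1%:R) <= 1 / 2 :> R.
    by rewrite ler_pdivrMr ?mulr_gt0//; lra.
  move: (_ / _) q0 q1 => q q0 q1; apply/andP; split; lra.
have mn' : (m < n.+1)%N by [].
have /matrixP/(_ (Ordinal mn') ord0) : V *m (invmx V *m e) = e by rewrite mulKVmx.
rewrite !mxE /= => <-; apply: eq_bigr => j _.
by rewrite mulrC [in RHS]mxE.
Qed.

Section steiner_polynomial.
Variables (R : realType) (n : nat) (n_gt0 : (0 < n)%N).
Implicit Types (Lam : nat -> {finite_measure set (pairB R n) -> \bar R}).
Implicit Types (eta : set (pairB R n)) (omega : set (vecB R n)).

Lemma measurable_setTX omega : measurable omega ->
  measurable ([set: 'rV[R]_n] `*` omega : set (pairB R n)).
Proof.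
move=> mo; rewrite (_ : _ `*` _ = [set: pairB R n] `&` snd @^-1` omega); last first.
  by apply/seteqP; split=> [[x y] []|[x y] []].
have msnd : measurable_fun [set: pairB R n] (snd : _ -> vecB R n).
  apply: (@measurability _ _ (pairB R n) (vecB R n) _ _ (@open 'rV[R]_n)) => //.
  move=> _ [B oB <-]; rewrite setTI; apply: sub_sigma_algebra.
  by apply: open_comp oB => x _; exact: cvg_snd.
exact: msnd.
Qed.

Lemma measurable_usphere : measurable (@usphere R n : set (vecB R n)).
Proof.
rewrite -[X in measurable X]setCK; apply: measurableC; apply: sub_sigma_algebra.
by apply: closed_openC; exact: closed_usphere.
Qed.

Lemma measurable_Sigma : measurable (@Sigma R n : set (pairB R n)).
Proof. by apply: measurable_setTX; exact: measurable_usphere. Qed.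

(** Real-valued through [fine], so that increments are ordinary differences. *)
Definition steiner_poly Lam (rho : R) eta : R :=
  \sum_(i < n) rho ^+ (n - i) * (kappa R (n - i) * fine (Lam i eta)).

Lemma steiner_coef_ge0 Lam eta i : 0 <= kappa R (n - i) * fine (Lam i eta).
Proof. by rewrite mulr_ge0 ?kappa_ge0 ?fine_ge0. Qed.

Lemma steiner_poly_mono Lam (s t : R) eta eta' : 0 <= s <= t -> eta `<=` eta' ->
  measurable eta -> measurable eta' ->
  steiner_poly Lam s eta <= steiner_poly Lam t eta'.
Proof.
move=> /andP[s0 st] ee me me'; apply: ler_sum => i _.
apply: ler_pM; rewrite ?exprn_ge0 ?steiner_coef_ge0//.
  by rewrite lerXn2r ?nnegrE// (le_trans s0).
rewrite ler_wpM2l ?kappa_ge0// fine_le ?fin_num_measure//.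
by rewrite le_measure ?inE.
Qed.

(** The bound is termwise with exponents at most [n]; the factors [2 ^+ (n - i)] reassemble to the
    polynomial at radius 2, which a volume bound controls. *)
Lemma steiner_poly_lip Lam (s t : R) eta : 0 <= s <= t -> t <= 2 ->
  steiner_poly Lam t eta - steiner_poly Lam s eta <=
  n%:R * steiner_poly Lam 2 eta * (t - s).
Proof.
move=> /andP[s0 st] t2; rewrite /steiner_poly -sumrB mulr_sumr mulr_suml.
apply: ler_sum => i _; rewrite -mulrBl.
set w := kappa _ _ * _; have w0 : 0 <= w by exact: steiner_coef_ge0.
rewrite (_ : n%:R * (2 ^+ (n - i) * w) * (t - s) =
  (n%:R * 2 ^+ (n - i) * (t - s)) * w); last by ring.
rewrite ler_wpM2r//; apply: le_trans (subXX_le _ _ t2) _; first by rewrite s0.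
by rewrite !ler_wpM2r ?subr_ge0 ?exprn_ge0// ler_nat leq_subr.
Qed.

(** The conditions on [c] select the exponent 1, that is [i = n.-1]. Since the weights sum to 0,
    subtracting the value at radius 1 changes nothing and only shells away from the body enter. *)
Lemma area_coefE Lam (c rho : 'I_n.+1 -> R) :
  (forall m, (m <= n)%N -> \sum_j c j * rho j ^+ m = (m == 1%N)%:R) ->
  forall eta, kappa R 1 * fine (Lam n.-1 eta) =
    \sum_j c j * (steiner_poly Lam (rho j) eta - steiner_poly Lam 1 eta).
Proof.
move=> H eta.
have c0 : \sum_j c j = 0 by have := H 0%N (leq0n _); under eq_bigr do rewrite expr0 mulr1.
have -> : \sum_j c j * (steiner_poly Lam (rho j) eta - steiner_poly Lam 1 eta) =
    \sum_j c j * steiner_poly Lam (rho j) eta - (\sum_j c j) * steiner_poly Lam 1 eta.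
  by rewrite mulr_suml -sumrB; apply: eq_bigr => j _; rewrite mulrBr.
rewrite c0 mul0r subr0 /steiner_poly.
under eq_bigr do rewrite mulr_sumr.
rewrite exchange_big /=.
under eq_bigr => i _ do under eq_bigr do rewrite mulrA.
under eq_bigr => i _ do rewrite -mulr_suml H ?leq_subr//.
have h : (n.-1 < n)%N by rewrite prednK.
rewrite (bigD1 (Ordinal h))//= big1 ?addr0.
  by rewrite -subn1 subKn// eqxx mul1r.
move=> i /eqP hi; rewrite (_ : (n - i == 1)%N = false) ?mul0r//.
apply/negP => /eqP hn; apply: hi; apply: val_inj => /=.
by rewrite -subn1 -hn subKn// ltnW.
Qed.

Section one_body.
Variables (K : set 'rV[R]_n) (cK : convex_body K).
Variables (Lam : nat -> {finite_measure set (pairB R n) -> \bar R}).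
Hypothesis smK : support_measures K Lam.

Lemma local_parallel_measureE (rho : R) eta : 0 < rho -> measurable eta ->
  eta `<=` @Sigma R n ->
  local_parallel_measure K rho eta = (steiner_poly Lam rho eta)%:E.
Proof.
move=> r0 me se; rewrite (smK.2 _ _ r0 me se) /steiner_poly -sumEFin.
apply: eq_bigr => i _.
by rewrite -[X in (_ * X)%E]fineK ?fin_num_measure// -EFinM mulrA.
Qed.

Definition shell (a b : R) eta : set 'rV[R]_n :=
  [set x | a < dist_to K x <= b /\ eta (nearest_pt K x, outer_dir K x)].

(** Points at distance at most [a] lie in the inner parallel set and the others in the shell, so
    subadditivity suffices. *)
Lemma steiner_poly_le_shell (a b : R) eta : 0 < a <= b -> measurable eta ->
  eta `<=` @Sigma R n ->
  ((steiner_poly Lam b eta)%:E <=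
    (steiner_poly Lam a eta)%:E + hausdorff_measure (shell a b eta))%E.
Proof.
move=> /andP[a0 ab] me se; have b0 := lt_le_trans a0 ab.
rewrite -!local_parallel_measureE//.
apply: le_trans (hausdorff_measureU _ _); apply: hausdorff_measure_subset.
move=> x /= [[Kx nKx] ex]; have [xa|ax] := leP (dist_to K x) a.
  by left; split=> //; split=> //; apply/parallel_dist.
by right; split=> //; rewrite ax/=; apply/parallel_dist.
Qed.

(** Additivity is available for sets at positive distance, so the inner radius is lowered from [a]
    to [a']: the distance function is 1-Lipschitz, which separates the two parts by more than
    [a - a']. *)
Lemma shell_le_steiner_poly (a' a b : R) eta : 0 < a' < a -> a <= b ->
  measurable eta -> eta `<=` @Sigma R n ->
  ((steiner_poly Lam a' eta)%:E + hausdorff_measure (shell a b eta) <=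
   (steiner_poly Lam b eta)%:E)%E.
Proof.
move=> /andP[a'0 a'a] ab me se; have b0 : 0 < b by lra.
rewrite -!local_parallel_measureE//.
have s0 : 0 < a - a' by rewrite subr_gt0.
apply: le_trans (hausdorff_measure_separated n_gt0 s0 _) _.
  move=> x y [[/(parallel_dist cK _ a'0) xa' _] _] [/andP[ay _] _].
  have := dist_to_lip cK y x; rewrite enormB; lra.
apply: hausdorff_measure_subset => x [[[Kx nKx] ex]|[/andP[ax xb] ex]].
  split=> //; split=> //; apply/parallel_dist => //.
  by move/(parallel_dist cK _ a'0): Kx; lra.
split=> //; split; first exact/parallel_dist.
by move=> /(dist_to_in cK) h; move: ax; rewrite h; lra.
Qed.

(** This is the only place where the enclosing ball enters the estimate of the polynomials, and the
    bound depends on [n] and [r] alone. *)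
Lemma steiner_poly2_le (z : 'rV[R]_n) (r : R) : 0 < r ->
  parallel K 2 `<=` cball z r ->
  steiner_poly Lam 2 (@Sigma R n) <= kappa R n * (Num.sqrt n%:R * r) ^+ n.
Proof.
move=> r0 Kr; rewrite -lee_fin -local_parallel_measureE//; last exact: measurable_Sigma.
apply: le_trans (hausdorff_measure_cball z n_gt0 r0).
by apply: hausdorff_measure_subset => x [[/Kr]].
Qed.

End one_body.

Section two_bodies.
Variables (K L : set 'rV[R]_n) (cK : convex_body K) (cL : convex_body L).
Variables (LamK LamL : nat -> {finite_measure set (pairB R n) -> \bar R}).
Hypotheses (smK : support_measures K LamK) (smL : support_measures L LamL).
Variables (delta : R) (d0 : 0 < delta) (d4 : delta <= 1 / 4).
Hypothesis KL : K `<=` parallel L delta.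
Hypothesis LK : L `<=` parallel K delta.

(** The bounds on [b] and [delta] keep [d_K] between 1 and 2 and [d_L] positive, as the comparison
    of directions requires. *)
Lemma shell_subset (b : R) (omega omega' : set 'rV[R]_n) : 1 <= b <= 3 / 2 ->
  omega `<=` @usphere R n ->
  (forall u v, usphere v -> omega u ->
    enorm (u - v) <= 6 * Num.sqrt delta -> omega' v) ->
  shell K 1 b (setT `*` omega) `<=` shell L (1 - delta) (b + delta) (setT `*` omega').
Proof.
move=> /andP[b1 b2] sS ss x [/andP[Kx1 Kxb] [_ ox]].
have dl := ltW d0.
have h1 := dist_to_hausdorff cK cL dl KL x.
have h2 := dist_to_hausdorff cL cK dl LK x.
have L0 : 0 < dist_to L x by move: d0 d4; lra.
split; first by apply/andP; split; move: d0 d4; lra.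
split=> //=; apply: ss ox _; first exact: outer_dir_sphere.
by apply: outer_dir_hausdorff => //; move: d0 d4; [lra|move=> _ _; apply/andP; split; lra].
Qed.

(** The loss consists of [n * M * delta] for raising the outer radius to [b + delta] and
    [2 * n * M * delta] for lowering the inner one to [1 - 2 * delta]. *)
Lemma steiner_poly_shift_le (b : R) (omega omega' : set (vecB R n)) (M : R) :
  1 <= b <= 3 / 2 ->
  measurable omega -> measurable omega' ->
  omega `<=` @usphere R n -> omega' `<=` @usphere R n ->
  (forall u v, usphere v -> omega u ->
    enorm (u - v) <= 6 * Num.sqrt delta -> omega' v) ->
  steiner_poly LamL 2 (@Sigma R n) <= M ->
  steiner_poly LamK b (setT `*` omega) - steiner_poly LamK 1 (setT `*` omega) <=
  steiner_poly LamL b (setT `*` omega') - steiner_poly LamL 1 (setT `*` omega') +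
  3 * n%:R * M * delta.
Proof.
move=> /[dup] b12 /andP[b1 b2] mo mo' sS sS' ss LM.
have me := measurable_setTX mo; have me' := measurable_setTX mo'.
have se : [set: 'rV[R]_n] `*` omega `<=` @Sigma R n by move=> [p u] [_ /sS].
have se' : [set: 'rV[R]_n] `*` omega' `<=` @Sigma R n by move=> [p u] [_ /sS'].
have b01 : (0 : R) < 1 <= b by rewrite ltr01.
have hK := steiner_poly_le_shell cK smK b01 me se.
have D0 := d0; have D4 := d4.
(* One [delta] is the displacement of the shell, the other the gap required for separation. *)
have a1 : (0 : R) < 1 - 2 * delta < 1 - delta by apply/andP; split; lra.
have a2 : 1 - delta <= b + delta by lra.
have hL := shell_le_steiner_poly cL smL a1 a2 me' se'.
have hKL := hausdorff_measure_subset (shell_subset b12 sS ss).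
have H : steiner_poly LamK b (setT `*` omega) + steiner_poly LamL (1 - 2 * delta) (setT `*` omega')
    <= steiner_poly LamK 1 (setT `*` omega) + steiner_poly LamL (b + delta) (setT `*` omega').
  rewrite -lee_fin !EFinD; apply: le_trans (leeD hK (lexx _)) _.
  rewrite -addeA; apply: leeD => //; rewrite addeC.
  by apply: le_trans hL; rewrite leeD.
have M' : steiner_poly LamL 2 (setT `*` omega') <= M.
  apply: le_trans LM; apply: steiner_poly_mono => //; last exact: measurable_Sigma.
  by rewrite lexx andbT.
have l1 : steiner_poly LamL (b + delta) (setT `*` omega') -
    steiner_poly LamL b (setT `*` omega') <= n%:R * M * delta.
  have h : 0 <= b <= b + delta by apply/andP; split; lra.
  have h' : b + delta <= 2 by lra.
  apply: le_trans (steiner_poly_lip LamL _ h h') _.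
  rewrite (_ : b + delta - b = delta); last by ring.
  by apply: ler_wpM2r; [exact: ltW|apply: ler_wpM2l].
have l2 : steiner_poly LamL 1 (setT `*` omega') -
    steiner_poly LamL (1 - 2 * delta) (setT `*` omega') <= n%:R * M * (2 * delta).
  have h : (0 : R) <= 1 - 2 * delta <= 1 by apply/andP; split; lra.
  have h' : 1 <= 2 :> R by lra.
  apply: le_trans (steiner_poly_lip LamL _ h h') _.
  rewrite subKr; apply: ler_wpM2r; last exact: ler_wpM2l.
  by rewrite mulr_ge0// ltW.
move: H l1 l2; lra.
Qed.

End two_bodies.

End steiner_polynomial.

(** * Layers of test functions *)

(** The sum counts the multiples of [eps] strictly below [y], so it is [y] rounded up to a multiple
    of [eps]. *)
Lemma staircase (R : realFieldType) (eps y : R) (N : nat) :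
  0 < eps -> 0 <= y -> y <= N%:R * eps ->
  y <= \sum_(k < N) eps * (k%:R * eps < y)%R%:R <= y + eps.
Proof.
move=> e0 y0.
(* The induction also carries the saturated case, where all [N] steps count. *)
suff [_] : (N%:R * eps < y -> \sum_(k < N) eps * (k%:R * eps < y)%R%:R = N%:R * eps) /\
  (y <= N%:R * eps -> y <= \sum_(k < N) eps * (k%:R * eps < y)%R%:R <= y + eps) by [].
elim: N => [|N [IH1 IH2]]; rewrite ?big_ord0 ?big_ord_recr ?mul0r /=.
  by split=> // h; apply/andP; split; lra.
rewrite -natr1 mulrDl mul1r; have [h|h] := ltP (N%:R * eps) y.
  rewrite IH1// mulr1; split=> // h'; apply/andP; split; lra.
rewrite mulr0 addr0; split=> [h'|_]; first by lra.
exact: IH2.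
Qed.

Section layers.
Local Open Scope ereal_scope.
Context d (T : measurableType d) (R : realType).
Variables (mu : {finite_measure set T -> \bar R}) (D : set T) (f : T -> R).
Hypotheses (mD : measurable D) (mf : measurable_fun D f).
Hypothesis f1 : forall x, D x -> (`|f x| <= 1)%R.

Lemma integrable_bounded1 : mu.-integrable D (EFin \o f).
Proof.
apply: measurable_bounded_integrable => //; first by rewrite ltey_eq fin_num_measure.
by exists 1%R; split=> // M M1 x Dx; apply: le_trans (f1 Dx) (ltW M1).
Qed.

Lemma integral_add_cst (c : R) :
  \int[mu]_(x in D) (f x + c)%:E =
  (fine (\int[mu]_(x in D) (f x)%:E) + c * fine (mu D))%:E.
Proof.
under eq_integral do rewrite EFinD.
rewrite integralD//; [|exact: integrable_bounded1|exact: finite_measure_integrable_cst].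
rewrite integral_cst// EFinD EFinM !fineK//; first exact: fin_num_measure.
by apply: integrable_fin_num => //; exact: integrable_bounded1.
Qed.

Lemma measurable_layer (t : R) : measurable (D `&` [set x | (t < f x)%R]).
Proof.
rewrite (_ : [set x | _] = f @^-1` [set` `]t, +oo[%R]); first exact: mf.
by apply/seteqP; split=> x /=; rewrite in_itv/= andbT.
Qed.

(** The staircase is applied to [f + 1], whose values lie in [[0, 2]] and are thus covered by [N]
    steps; subtracting the mass of [D] undoes the shift. *)
Lemma integral_layers (eps : R) (N : nat) : (0 < eps)%R -> (2 <= N%:R * eps)%R ->
  let G := (eps * (\sum_(k < N) fine (mu (D `&` [set x | -1 + k%:R * eps < f x])))
            - fine (mu D))%R in
  (G - eps * fine (mu D) <= fine (\int[mu]_(x in D) (f x)%:E) <= G)%R.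
Proof.
move=> e0 N2; set I := fine (\int[mu]_(x in D) _).
pose A (k : 'I_N) := D `&` [set x | (-1 + k%:R * eps < f x)%R].
have mA k : measurable (A k) by exact: measurable_layer.
pose g x := (\sum_(k < N) eps * \1_(A k) x)%R.
have gI : \int[mu]_(x in D) (g x)%:E = (eps * \sum_(k < N) fine (mu (A k)))%:E.
  under eq_integral do rewrite /g -sumEFin.
  rewrite ge0_integral_sum//; last first.
  - by move=> k x _; rewrite lee_fin mulr_ge0// ltW.
  - move=> k; apply/measurable_EFinP; apply: measurable_funM.
      exact: measurable_cst.
    exact: measurable_indic.
  rewrite mulr_sumr -sumEFin; apply: eq_bigr => k _.
  under eq_integral do rewrite EFinM.
  rewrite ge0_integralZl_EFin//; last 2 first.
  - apply/measurable_EFinP; exact: measurable_indic.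
  - exact: ltW.
  rewrite integral_indic// EFinM fineK ?fin_num_measure//.
  by rewrite /A setIAC setIid.
have gm : measurable_fun D (EFin \o g).
  apply/measurable_EFinP; apply: measurable_sum => k; apply: measurable_funM.
      exact: measurable_cst.
    exact: measurable_indic.
have fcm c : measurable_fun D (fun x => (f x + c)%:E).
  by apply/measurable_EFinP; apply: measurable_funD.
have fg x : D x -> (f x + 1 <= g x <= f x + (1 + eps))%R.
  move=> Dx; have := f1 Dx; rewrite ler_norml => /andP[fx1 fx2].
  have -> : g x = (\sum_(k < N) eps * (k%:R * eps < f x + 1)%R%:R)%R.
    apply: eq_bigr => k _; rewrite indicE; congr (_ * _%:R)%R; congr nat_of_bool.
    apply/idP/idP => [/set_mem[_ /=]|h]; first by lra.
    by apply/mem_set; split=> //=; lra.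
  by rewrite addrA; apply: staircase => //; lra.
have f10 x : D x -> (0 <= f x + 1)%R.
  by move=> Dx; have := f1 Dx; rewrite ler_norml => /andP[]; lra.
have up : \int[mu]_(x in D) (f x + 1)%:E <= \int[mu]_(x in D) (g x)%:E.
  apply: ge0_le_integral => // x Dx; rewrite lee_fin ?f10//.
  by have /andP[] := fg _ Dx.
have dn : \int[mu]_(x in D) (g x)%:E <= \int[mu]_(x in D) (f x + (1 + eps))%:E.
  apply: ge0_le_integral => // x Dx; have /andP[h1 h2] := fg _ Dx; rewrite lee_fin//.
  by apply: le_trans h1; exact: f10.
move: up dn; rewrite !integral_add_cst gI !lee_fin -/I /A => up dn.
by apply/andP; split; lra.
Qed.

End layers.

Section lipschitz_on_sphere.
Variables (R : realType) (n : nat) (f : 'rV[R]_n -> R).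
Hypothesis lipf : forall a b, usphere a -> usphere b -> `|f a - f b| <= enorm (a - b).

(** Off the sphere [f] is arbitrary, so the level set is exhibited as the trace of an open set, a
    union of balls on which the Lipschitz bound keeps [f] above [t]. *)
Lemma measurable_level (t : R) :
  measurable ((@usphere R n `&` [set u | t < f u]) : set (vecB R n)).
Proof.
pose U := \bigcup_(u in @usphere R n `&` [set u | t < f u])
  [set v | enorm (v - u) < f u - t].
have oU : open U by apply: bigcup_open => u _; exact: open_eball.
rewrite (_ : _ `&` _ = @usphere R n `&` U).
  apply: measurableI; first exact: measurable_usphere.
  exact: sub_sigma_algebra.
apply/seteqP; split=> [u [Su tu]|v [Sv [u [Su /= tu] /= uv]]].
  by split=> //; exists u => //=; rewrite subrr enorm0 subr_gt0.
split=> //=; have := lipf Sv Su; rewrite ler_norml => /andP[h _].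
by lra.
Qed.

Lemma measurable_fun_lipschitz : measurable_fun (@usphere R n : set (vecB R n)) f.
Proof.
move=> mS; apply: (measurability _ (RGenOInfty.measurableE R)) => //.
move=> _ [_ [x ->] <-].
rewrite (_ : f @^-1` _ = [set u | x < f u]); first exact: measurable_level.
by apply/seteqP; split=> u /=; rewrite in_itv/= andbT.
Qed.

End lipschitz_on_sphere.

Lemma lip_norm_le1 (R : realType) (n : nat) (f : 'rV[R]_n -> R) :
  (lip_norm f <= 1)%E ->
  forall a b, usphere a -> usphere b -> `|f a - f b| <= enorm (a - b).
Proof.
move=> f1 a b Sa Sb; have [->|ab] := eqVneq a b.
  by rewrite !subrr normr0 enorm0.
have e0 : 0 < enorm (a - b).
  rewrite lt_neqAle enorm_ge0 andbT eq_sym; apply/eqP => /enorm_eq0/eqP.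
  by rewrite subr_eq0 (negbTE ab).
rewrite -[leRHS]mul1r -ler_pdivrMr// -lee_fin; apply: le_trans f1.
by apply: ereal_sup_ubound; exists (a, b) => //=; split=> //; exact/eqP.
Qed.

Lemma sup_norm_le1 (R : realType) (n : nat) (f : 'rV[R]_n -> R) :
  (sup_norm f <= 1)%E -> forall a, usphere a -> `|f a| <= 1.
Proof.
move=> f1 a Sa; rewrite -lee_fin; apply: le_trans f1.
by apply: ereal_sup_ubound; exists a.
Qed.

(** * Area measures *)

(** Adding the nonnegative term [b N] turns the shifted sum into the unshifted one, at the price of
    [b 0]. *)
Lemma sum_shift_le (R : realDomainType) (a b : nat -> R) (e : R) (N : nat) :
  (forall k, a k.+1 <= b k + e) -> 0 <= b N ->
  \sum_(k < N) a k.+1 <= \sum_(k < N) b k.+1 + b 0%N + N%:R * e.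
Proof.
move=> H bN; apply: (@le_trans _ _ (\sum_(k < N) (b k + e))); first by apply: ler_sum.
rewrite big_split /= sumr_const card_ord mulr_natl lerD2r.
apply: (@le_trans _ _ (\sum_(k < N.+1) b k)).
  by rewrite big_ord_recr/= lerDl.
by rewrite big_ord_recl addrC.
Qed.

Lemma linear_comb_dist (R : realDomainType) (I : finType) (c x y : I -> R) (B : R) :
  (forall j, `|x j - y j| <= B) ->
  `|\sum_j c j * x j - \sum_j c j * y j| <= (\sum_j `|c j|) * B.
Proof.
move=> H; rewrite -sumrB mulr_suml; apply: le_trans (ler_norm_sum _ _ _) _.
by apply: ler_sum => j _; rewrite -mulrBr normrM ler_wpM2l.
Qed.

Section area_measures.
Variables (R : realType) (n : nat) (n_gt0 : (0 < n)%N).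
Implicit Types (Lam : nat -> {finite_measure set (pairB R n) -> \bar R}).
Implicit Types (omega : set (vecB R n)).

Lemma fine_area_measure Lam omega : measurable omega ->
  fine (area_measure Lam omega) = 2 * fine (Lam n.-1 (setT `*` omega)).
Proof.
move=> mo; rewrite /area_measure fineM// fin_num_measure//.
exact: measurable_setTX.
Qed.

Definition steiner_incr Lam (b : R) omega : R :=
  steiner_poly Lam b (setT `*` omega) - steiner_poly Lam 1 (setT `*` omega).

Lemma steiner_incr_ge0 Lam b omega : 1 <= b -> measurable omega ->
  0 <= steiner_incr Lam b omega.
Proof.
move=> b1 mo; rewrite subr_ge0; apply: steiner_poly_mono => //.
- by rewrite ler01 b1.
- exact: measurable_setTX.
- exact: measurable_setTX.
Qed.

Lemma steiner_incr_le Lam b omega : 1 <= b <= 2 -> measurable omega ->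
  omega `<=` @usphere R n ->
  steiner_incr Lam b omega <= steiner_poly Lam 2 (@Sigma R n).
Proof.
move=> /andP[b1 b2] mo So; have me := measurable_setTX mo.
apply: (@le_trans _ _ (steiner_poly Lam b (setT `*` omega))).
  rewrite gerBl; apply: sumr_ge0 => i _.
  by rewrite mulr_ge0 ?exprn_ge0 ?steiner_coef_ge0.
apply: steiner_poly_mono => //; last exact: measurable_Sigma.
  by rewrite b2 andbT; lra.
by move=> [p u] [_ /So].
Qed.

(** The linear term is one of the nonnegative terms of the polynomial at radius 2. *)
Lemma area_measure_usphere_le Lam :
  fine (area_measure Lam (@usphere R n)) <=
  2 / kappa R 1 * steiner_poly Lam 2 (@Sigma R n).
Proof.
have k0 := kappa1_gt0 R.
rewrite fine_area_measure; last exact: measurable_usphere.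
rewrite -mulrA ler_wpM2l// mulrC ler_pdivlMr// mulrC.
have h : (n.-1 < n)%N by rewrite prednK.
rewrite /steiner_poly (bigD1 (Ordinal h))//=.
rewrite (_ : (n - n.-1)%N = 1%N); last by rewrite -subn1 subKn.
set w := kappa R 1 * _; have w0 : 0 <= w by rewrite mulr_ge0 ?kappa_ge0 ?fine_ge0.
set s := \sum_(_ < _ | _) _; have s0 : 0 <= s.
  by apply: sumr_ge0 => i _; rewrite mulr_ge0 ?exprn_ge0 ?steiner_coef_ge0.
by rewrite expr1; lra.
Qed.

Variables (c rho : 'I_n.+1 -> R).
Hypothesis rhoP : forall j, 1 <= rho j <= 3 / 2.
Hypothesis crhoP : forall m, (m <= n)%N -> \sum_j c j * rho j ^+ m = (m == 1%N)%:R.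

Lemma area_measureE Lam omega : measurable omega ->
  fine (area_measure Lam omega) =
  2 / kappa R 1 * \sum_j c j * steiner_incr Lam (rho j) omega.
Proof.
move=> mo; rewrite fine_area_measure// -(area_coefE n_gt0 Lam crhoP).
by field; rewrite gt_eqF ?kappa1_gt0.
Qed.

Section two_bodies.
Variables (K L : set 'rV[R]_n) (cK : convex_body K) (cL : convex_body L).
Variables (LamK LamL : nat -> {finite_measure set (pairB R n) -> \bar R}).
Hypotheses (smK : support_measures K LamK) (smL : support_measures L LamL).
Variables (delta : R) (d0 : 0 < delta) (d16 : delta <= 1 / 16).
Hypothesis KL : K `<=` parallel L delta.
Hypothesis LK : L `<=` parallel K delta.
Variable M : R.
Hypothesis LM : steiner_poly LamL 2 (@Sigma R n) <= M.
Variable f : 'rV[R]_n -> R.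
Hypothesis lipf : forall a b, usphere a -> usphere b -> `|f a - f b| <= enorm (a - b).

Let eps := 6 * Num.sqrt delta.
(** The index is offset by one: [level k.+1] is layer [k] of [integral_layers], and [level 0] lies
    one step below to receive the shift. *)
Let level (k : nat) : set (vecB R n) :=
  @usphere R n `&` [set u | -1 + (k%:R - 1) * eps < f u].

(** Moving a direction by at most [eps] lowers [f] by at most [eps], so [level k.+1] lands in
    [level k]. The shift of index leaves over the increment of [level 0], which is at most [M]. *)
Lemma layers_shift_le (b : R) (N : nat) : 1 <= b <= 3 / 2 ->
  \sum_(k < N) steiner_incr LamK b (level k.+1) <=
  \sum_(k < N) steiner_incr LamL b (level k.+1) + M + N%:R * (3 * n%:R * M * delta).
Proof.
move=> /[dup] b12 /andP[b1 b2].
have mlv k : measurable (level k) by exact: measurable_level.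
have H k : steiner_incr LamK b (level k.+1) <=
    steiner_incr LamL b (level k) + 3 * n%:R * M * delta.
  apply: (steiner_poly_shift_le n_gt0 cK cL smK smL d0 _ KL LK b12) => //.
  - by move: d16; lra.
  - by move=> u [].
  - by move=> u [].
  move=> u v Sv [Su /= fu] uv; split=> //=.
  have := lipf Su Sv; rewrite ler_norml => /andP[_ h].
  move: fu uv; rewrite -/eps -natr1; lra.
have N0 : 0 <= steiner_incr LamL b (level N) by exact: steiner_incr_ge0.
apply: le_trans (@sum_shift_le _ (fun k => steiner_incr LamK b (level k))
  (fun k => steiner_incr LamL b (level k)) _ _ H N0) _.
rewrite lerD2r lerD2l; apply: le_trans LM; apply: steiner_incr_le => //.
  by apply/andP; split; lra.
by move=> u [].
Qed.

(** The whole sphere is its own neighbourhood, so no level is lost. This serves the mass term of the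
    layer formula, which carries no factor [eps]. *)
Lemma usphere_shift_le (b : R) : 1 <= b <= 3 / 2 ->
  steiner_incr LamK b (@usphere R n) <=
  steiner_incr LamL b (@usphere R n) + 3 * n%:R * M * delta.
Proof.
move=> b12; have mS := @measurable_usphere R n.
apply: (steiner_poly_shift_le n_gt0 cK cL smK smL d0 _ KL LK b12) => //.
by move: d16; lra.
Qed.

End two_bodies.

Section integrals.
Variables (K L : set 'rV[R]_n) (cK : convex_body K) (cL : convex_body L).
Variables (LamK LamL : nat -> {finite_measure set (pairB R n) -> \bar R}).
Hypotheses (smK : support_measures K LamK) (smL : support_measures L LamL).
Variables (delta : R) (d0 : 0 < delta).
Hypothesis KL : K `<=` parallel L delta.
Hypothesis LK : L `<=` parallel K delta.
Variable M : R.
Hypothesis KM : steiner_poly LamK 2 (@Sigma R n) <= M.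
Hypothesis LM : steiner_poly LamL 2 (@Sigma R n) <= M.
Variable f : 'rV[R]_n -> R.
Hypothesis lipf : forall a b, usphere a -> usphere b -> `|f a - f b| <= enorm (a - b).
Hypothesis f1 : forall a, usphere a -> `|f a| <= 1.

Let I Lam : R := fine (\int[area_measure Lam]_(u in @usphere R n) (f u)%:E).
Let q := 2 / kappa R 1.
Let A := \sum_j `|c j|.

Let q_gt0 : 0 < q. Proof. by rewrite divr_gt0 ?kappa1_gt0. Qed.
Let A_ge0 : 0 <= A. Proof. by apply: sumr_ge0. Qed.
Let M_ge0 : 0 <= M.
Proof.
by apply: le_trans KM; apply: sumr_ge0 => i _; rewrite mulr_ge0 ?exprn_ge0 ?steiner_coef_ge0.
Qed.

Let mass_le Lam : steiner_poly Lam 2 (@Sigma R n) <= M ->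
  0 <= fine (area_measure Lam (@usphere R n)) <= q * M.
Proof.
move=> h; rewrite fine_ge0//=; apply: le_trans (area_measure_usphere_le Lam) _.
by rewrite ler_wpM2l// ltW.
Qed.

Let mf := measurable_fun_lipschitz lipf.
Let mS := @measurable_usphere R n.

Lemma integral_area_le Lam : steiner_poly Lam 2 (@Sigma R n) <= M ->
  `|I Lam| <= 3 * q * M.
Proof.
move=> h; have /andP[m0 mM] := mass_le h.
(* A single layer of height 2 suffices for a crude bound by three times the mass. *)
have N1 : 2 <= 1%:R * 2 :> R by rewrite mul1r.
have := @integral_layers _ _ _ (area_measure Lam) _ f mS mf f1 2 1 (ltr0n _ 2) N1.
rewrite /= big_ord1 mul0r addr0 => /andP[].
set w := fine (area_measure Lam (_ `&` _)) => h1 h2.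
have w0 : 0 <= w by rewrite fine_ge0.
have wm : w <= fine (area_measure Lam (@usphere R n)).
  rewrite fine_le ?fin_num_measure//; try exact: measurable_level.
  by rewrite le_measure ?inE//; exact: measurable_level.
rewrite ler_norml; apply/andP; split; move: h1 h2; rewrite -/(I Lam); lra.
Qed.

(** With about [2 / eps] layers of height [eps], the errors of order [delta] per layer add up to
    order [delta]. The level lost in the shift and the rounding of the staircase each cost order
    [eps], that is [sqrt delta]. *)
Lemma integral_area_dist_small : delta <= 1 / 16 ->
  `|I LamK - I LamL| <= q * M * (A * (3 * n%:R + 1) + 1) * (6 * Num.sqrt delta).
Proof.
move=> d16; set s := Num.sqrt delta.
have s0 : 0 < s by rewrite sqrtr_gt0.
have ss : delta = s ^+ 2 by rewrite sqr_sqrtr// ltW.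
have s4 : s <= 1 / 4.
  by rewrite leNgt; apply/negP => h; move: d16; rewrite ss expr2; nra.
have ds : delta <= s / 4 by rewrite ss expr2; nra.
set eps := 6 * s; have e0 : 0 < eps by rewrite mulr_gt0.
pose N := (Num.trunc (2 / eps)).+1.
have N1 : 2 <= N%:R * eps.
  by rewrite -ler_pdivrMr// ltW// Num.Theory.truncnS_gt.
(* One step beyond 2 suffices, and [eps <= 3 / 2] because [s <= 1 / 4]. *)
have N2 : N%:R * eps <= 4.
  have : (Num.trunc (2 / eps))%:R * eps <= 2.
    by rewrite -ler_pdivlMr// Num.Theory.truncn_le divr_ge0// ltW.
  rewrite /N -natr1 mulrDl mul1r /eps; lra.
pose level (k : nat) : set (vecB R n) :=
  @usphere R n `&` [set u | -1 + (k%:R - 1) * eps < f u].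
have mlv k : measurable (level k) by exact: measurable_level.
pose S Lam (b : R) := \sum_(k < N) steiner_incr Lam b (level k.+1).
pose E := M + N%:R * (3 * n%:R * M * delta).
have S_dist j : `|S LamK (rho j) - S LamL (rho j)| <= E.
  have h1 := layers_shift_le cK cL smK smL d0 d16 KL LK LM lipf N (rhoP j).
  have h2 := layers_shift_le cL cK smL smK d0 d16 LK KL KM lipf N (rhoP j).
  by rewrite ler_norml /S /E; apply/andP; split; move: h1 h2; rewrite -/s -/eps -/level; lra.
have m_dist j : `|steiner_incr LamK (rho j) (@usphere R n) -
    steiner_incr LamL (rho j) (@usphere R n)| <= 3 * n%:R * M * delta.
  have h1 := usphere_shift_le cK cL smK smL d0 d16 KL LK LM (rhoP j).
  have h2 := usphere_shift_le cL cK smL smK d0 d16 LK KL KM (rhoP j).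
  by rewrite ler_norml; apply/andP; split; move: h1 h2; lra.
pose m Lam := fine (area_measure Lam (@usphere R n)).
pose T Lam := \sum_(k < N) fine (area_measure Lam (level k.+1)).
have TE Lam : T Lam = q * \sum_j c j * S Lam (rho j).
  rewrite /T; under eq_bigr do rewrite area_measureE//.
  rewrite -mulr_sumr exchange_big /=; congr (_ * _).
  by apply: eq_bigr => j _; rewrite mulr_sumr.
have T_dist : `|T LamK - T LamL| <= q * (A * E).
  rewrite !TE -mulrBr normrM (gtr0_norm q_gt0) ler_wpM2l ?(ltW q_gt0)//.
  exact: linear_comb_dist.
have mm_dist : `|m LamK - m LamL| <= q * (A * (3 * n%:R * M * delta)).
  rewrite /m !area_measureE// -/q -mulrBr normrM (gtr0_norm q_gt0).
  by rewrite ler_wpM2l ?(ltW q_gt0)//; exact: linear_comb_dist.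
have I_T Lam : eps * T Lam - m Lam - eps * m Lam <= I Lam <= eps * T Lam - m Lam.
  have := @integral_layers _ _ _ (area_measure Lam) _ f mS mf f1 eps N e0 N1.
  rewrite /= -/(I Lam) -/(m Lam) (_ : \sum_(k < N) _ = T Lam)//.
  apply: eq_bigr => k _; congr (fine (area_measure Lam (_ `&` _))).
  by rewrite -natr1 addrK.
have /andP[K1 K2] := I_T LamK; have /andP[L1 L2] := I_T LamL.
have /andP[mK0 mK1] := mass_le KM; have /andP[mL0 mL1] := mass_le LM.
have emK : eps * m LamK <= eps * (q * M) by rewrite ler_wpM2l// ltW.
have emL : eps * m LamL <= eps * (q * M) by rewrite ler_wpM2l// ltW.
have eT : `|eps * T LamK - eps * T LamL| <= eps * (q * (A * E)).
  by rewrite -mulrBr normrM gtr0_norm// ler_wpM2l// ltW.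
have main : `|I LamK - I LamL| <=
    eps * (q * (A * E)) + q * (A * (3 * n%:R * M * delta)) + eps * (q * M).
  move: eT mm_dist; rewrite !ler_norml => /andP[? ?] /andP[? ?].
  by apply/andP; split; lra.
apply: le_trans main _.
have q0 := ltW q_gt0; have qAM0 : 0 <= q * A * M := mulr_ge0 (mulr_ge0 q0 A_ge0) M_ge0.
have nM0 : 0 <= q * A * M * n%:R := mulr_ge0 qAM0 (ler0n _ _).
have h1 : eps * (q * (A * E)) <= eps * (q * A * M) + q * A * M * n%:R * (12 * delta).
  rewrite (_ : eps * _ = eps * (q * A * M) +
    q * A * M * n%:R * (3 * delta) * (N%:R * eps)); last by rewrite /E; ring.
  rewrite lerD2l (_ : q * A * M * n%:R * (12 * delta) =
    q * A * M * n%:R * (3 * delta) * 4); last by ring.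
  by rewrite ler_wpM2l// (mulr_ge0 nM0)// mulr_ge0// ltW.
(* The 15 collects 12 from the layers and 3 from the masses; [delta <= s / 4] absorbs it into
   [3 * eps]. *)
have h2 : q * A * M * n%:R * (15 * delta) <= q * A * M * n%:R * (3 * eps).
  by rewrite ler_wpM2l// /eps; lra.
move: h1 h2; rewrite -/eps.
lra.
Qed.

Lemma integral_area_dist :
  `|I LamK - I LamL| <= q * M * (6 * (A * (3 * n%:R + 1)) + 30) * Num.sqrt delta.
Proof.
have s0 := sqrtr_ge0 delta.
have qM0 : 0 <= q * M by rewrite mulr_ge0// ltW.
have B0 : 0 <= A * (3 * n%:R + 1) by rewrite mulr_ge0// addr_ge0 ?mulr_ge0.
have [d16|d16] := leP delta (1 / 16).
  apply: le_trans (integral_area_dist_small d16) _.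
  move: B0; set B := A * _ => B0.
  rewrite (_ : q * M * (B + 1) * _ = q * M * (6 * B + 6) * Num.sqrt delta); last by ring.
  by apply: ler_wpM2r => //; apply: ler_wpM2l => //; lra.
have s4 : 1 / 4 <= Num.sqrt delta.
  rewrite leNgt; apply/negP => h; move: d16.
  by rewrite -(sqr_sqrtr (ltW d0)) expr2; nra.
have hK := integral_area_le KM; have hL := integral_area_le LM.
apply: le_trans (ler_normB _ _) _.
(* For large [delta] the two crude bounds sum to [6 * q * M], below [30 / 4 * q * M]. *)
have : q * M * 30 * (1 / 4) <= q * M * (6 * (A * (3 * n%:R + 1)) + 30) * Num.sqrt delta.
  apply: ler_pM => //; first by rewrite mulr_ge0.
  by rewrite ler_wpM2l//; lra.
lra.
Qed.

End integrals.

Lemma dbL_area_le (K L : set 'rV[R]_n) LamK LamL (delta M : R) :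
  convex_body K -> convex_body L ->
  support_measures K LamK -> support_measures L LamL -> 0 < delta ->
  K `<=` parallel L delta -> L `<=` parallel K delta ->
  steiner_poly LamK 2 (@Sigma R n) <= M -> steiner_poly LamL 2 (@Sigma R n) <= M ->
  (dbL (area_measure LamK) (area_measure LamL) <=
    (2 / kappa R 1 * M * (6 * ((\sum_j `|c j|) * (3 * n%:R + 1)) + 30) * Num.sqrt delta)%:E)%E.
Proof.
move=> cK cL smK smL d0 KL LK KM LM.
apply: ge_ereal_sup => _ [f [/lip_norm_le1 lipf /sup_norm_le1 f1] <-].
have mS := @measurable_usphere R n.
have fin Lam : (\int[area_measure Lam]_(u in @usphere R n) (f u)%:E)%E \is a fin_num.
  apply: integrable_fin_num => //; apply: integrable_bounded1 => //.
  exact: measurable_fun_lipschitz.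
rewrite -(fineK (fin LamK)) -(fineK (fin LamL)) -EFinB abse_EFin lee_fin.
exact: (integral_area_dist cK cL smK smL d0 KL LK KM LM lipf f1).
Qed.

End area_measures.

(** * The Hausdorff distance and the final estimate *)

Section hausdorff_distance.
Variables (R : realType) (n : nat) (K L : set 'rV[R]_n).

Lemma parallel_mono (s t : R) : 0 <= s <= t -> 0 < t -> parallel K s `<=` parallel K t.
Proof.
move=> /andP[s0 st] t0 x /(parallel_le s0)[a Ka xa]; apply/parallelP => //.
by exists a => //; exact: le_trans st.
Qed.

Lemma cball_sub_parallel (z : 'rV[R]_n) (r : R) : 0 < r -> L !=set0 ->
  K `<=` cball z r -> L `<=` cball z r -> K `<=` parallel L (2 * r).
Proof.
move=> r0 [y Ly] Kr Lr x Kx; apply/parallelP; first by rewrite mulr_gt0.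
exists y => //; have := Kr _ Kx; have := Lr _ Ly; have := enorm_triangle z x y.
by rewrite /cball /= (enormB y z); lra.
Qed.

End hausdorff_distance.

(** Some admissible radius lies below [t], and inclusions persist for larger radii. The radius
    [2 * r] shows that the infimum is over a nonempty set, so it is not the default value. *)
Lemma hausdorff_dist_lt (R : realType) (n : nat) (K L : set 'rV[R]_n)
    (z : 'rV[R]_n) (r t : R) : 0 < r -> K !=set0 -> L !=set0 ->
  K `<=` cball z r -> L `<=` cball z r -> 0 < t -> hausdorff_dist K L < t ->
  K `<=` parallel L t /\ L `<=` parallel K t.
Proof.
move=> r0 K0 L0 Kr Lr t0 ht.
pose S := [set rho : R | [/\ 0 <= rho, K `<=` parallel L rho & L `<=` parallel K rho]].
have hS : S !=set0.
  exists (2 * r); split; first by rewrite mulr_ge0// ltW.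
    exact: cball_sub_parallel Lr.
  exact: cball_sub_parallel Kr.
have [s [s0 KL LK] st] := inf_lt hS ht.
split=> x h; first by apply: (parallel_mono _ t0 (KL _ h)); rewrite s0 ltW.
by apply: (parallel_mono _ t0 (LK _ h)); rewrite s0 ltW.
Qed.

Lemma hausdorff_dist_ge0 (R : realType) (n : nat) (K L : set 'rV[R]_n) :
  0 <= hausdorff_dist K L.
Proof.
rewrite /hausdorff_dist; set S := mkset _.
have [->|/set0P S0] := eqVneq S set0; first by rewrite inf0.
by apply: lb_le_inf => // s [].
Qed.

Lemma sqrtD_le (R : rcfType) (a b : R) : 0 <= a -> 0 <= b ->
  Num.sqrt (a + b) <= Num.sqrt a + Num.sqrt b.
Proof.
move=> a0 b0; rewrite -(@ler_pXn2r _ 2) ?nnegrE ?addr_ge0 ?sqrtr_ge0//.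
rewrite sqrrD !sqr_sqrtr ?addr_ge0// addrAC lerDl.
by rewrite mulrn_wge0// mulr_ge0 ?sqrtr_ge0.
Qed.

Unset Implicit Arguments.

Theorem mainTheorem2 (R : realType) (n : nat) (n_gt0 : (0 < n)%N)
    (r : R) (r_gt0 : 0 < r) :
  exists C : R,
    forall (K L : set 'rV[R]_n)
      (LamK LamL : nat -> {finite_measure set (pairB R n) -> \bar R}),
    convex_body K -> convex_body L ->
    (exists z : 'rV[R]_n,
       parallel K 2 `<=` cball z r /\ parallel L 2 `<=` cball z r) ->
    support_measures K LamK -> support_measures L LamL ->
    (dbL (area_measure LamK) (area_measure LamL)
       <= (C * Num.sqrt (hausdorff_dist K L))%:E)%E.
Proof.
(* The weights and nodes depend on [n] only, so [C0] is fixed before the bodies are chosen. *)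
have [c [rho [rhoP crhoP]]] := steiner_nodes R n.
pose M := kappa R n * (Num.sqrt n%:R * r) ^+ n.
have M0 : 0 <= M by rewrite mulr_ge0 ?kappa_ge0// exprn_ge0// mulr_ge0 ?sqrtr_ge0// ltW.
pose C0 := 2 / kappa R 1 * M * (6 * ((\sum_j `|c j|) * (3 * n%:R + 1)) + 30).
have C00 : 0 <= C0.
  have k0 : 0 <= 2 / kappa R 1 by rewrite divr_ge0 ?kappa_ge0.
  have A0 : 0 <= \sum_j `|c j| by apply: sumr_ge0.
  have B0 : 0 <= 3 * n%:R + 1 :> R by rewrite addr_ge0 ?mulr_ge0.
  apply: mulr_ge0; first exact: mulr_ge0.
  by apply: addr_ge0 => //; apply: mulr_ge0 => //; exact: mulr_ge0.
exists C0 => K L LamK LamL cK cL [z [Kz Lz]] smK smL.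
have KM := steiner_poly2_le n_gt0 smK r_gt0 Kz.
have LM := steiner_poly2_le n_gt0 smL r_gt0 Lz.
have [K0 _ _] := cK; have [L0 _ _] := cL.
have Kr := subset_trans (@sub_parallel _ _ K 2) Kz.
have Lr := subset_trans (@sub_parallel _ _ L 2) Lz.
have h0 := hausdorff_dist_ge0 K L.
set h := hausdorff_dist K L in h0 *.
apply/lee_addgt0Pr => e e0; rewrite -EFinD.
(* The estimate is applied at the positive radius [h + t], which covers [h = 0]; this [t] gives
   [C0 * sqrt t <= e], and the [+ 1] guards against [C0 = 0]. *)
pose t := (e / (C0 + 1)) ^+ 2.
have q0 : 0 < e / (C0 + 1) by rewrite divr_gt0// ltr_wpDl.
have t0 : 0 < t by rewrite exprn_gt0.
have ht0 : 0 < h + t by rewrite ltr_wpDl.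
have hlt : hausdorff_dist K L < h + t by rewrite ltrDl.
have [KL LK] := hausdorff_dist_lt r_gt0 K0 L0 Kr Lr ht0 hlt.
apply: le_trans (dbL_area_le n_gt0 rhoP crhoP cK cL smK smL ht0 KL LK KM LM) _.
rewrite lee_fin -/M -/C0.
apply: le_trans (ler_wpM2l C00 (sqrtD_le h0 (ltW t0))) _.
rewrite mulrDr lerD2l sqrtr_sqr gtr0_norm// mulrA ler_pdivrMr ?ltr_wpDl//.
by rewrite mulrDr mulr1 mulrC lerDl ltW.
Qed.
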